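(* Let $N_A,N_B,N_C\ge 3$ be integers, possibly depending on $\beta$, with $N_A+N_B+N_C=2N+1$, and let $M=\min\{N_A,N_B,N_C\}$ and $M^*=\max\{N_A,N_B,N_C\}$. Assume that $$\lim_{\beta\to\infty}N^3\,4^{M^*}e^{-\beta}=0 .$$ Then, for every $k\in\Lambda_N$ and $t\ge 0$, $$\lim_{\beta\to\infty}\mathbf{E}^{\beta}_{\omega_k}\left[\int_0^t\mathbf 1\{\eta(sN^2e^{M\beta})\notin\Omega^N_0\}\,ds\right]=0 .$$
   Context: $\Lambda_N=\{-N,\dots,N\}$ is the discrete ring with $2N+1$ sites (indices modulo $2N+1$). $\Omega^N$ is the set of $\omega:\Lambda_N\to\{A,B,C\}$ with exactly $N_\alpha$ sites of type $\alpha$ for each $\alpha\in\{A,B,C\}$. $\sigma^{i,j}\omega$ is obtained from $\omega$ by exchanging the particles at sites $i$ and $j$. ABC process: $\{\eta(t):t\ge 0\}$ (depending on $\beta$) is the continuous-time Markov chain on $\Omega^N$ with generator $(L_\beta f)(\omega)=\sum_{k\in\Lambda_N}c_k^\beta(\omega)[f(\sigma^{k,k+1}\omega)-f(\omega)]$, where $c^\beta_k(\omega)=e^{-\beta}$ if $(\omega(k),\omega(k+1))\in\{(A,B),(B,C),(C,A)\}$ and $c^\beta_k(\omega)=1$ otherwise. $\mathbf P^\beta_\omega$, $\mathbf E^\beta_\omega$ denote the law and expectation of the process started from $\omega$. Segregated configurations: $\omega_0(j)=A$ for $0\le j\le N_A-1$, $\omega_0(j)=B$ for $N_A\le j\le N_A+N_B-1$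 (indices modulo $2N+1$), and $\omega_0(j)=C$ otherwise; $\omega_k=\Theta^k\omega_0$ with $(\Theta^k\omega)(i)=\omega(i-k)$; $\Omega^N_0=\{\omega_k:k\in\Lambda_N\}$. *)

(* Defs.v *)
From HB Require Import structures.
From mathcomp Require Import all_boot all_order all_fingroup all_algebra.
From mathcomp Require Import all_classical all_reals all_analysis.

Set Implicit Arguments.
Unset Strict Implicit.
Unset Printing Implicit Defensive.

Import Order.TTheory GRing.Theory Num.Theory.
Import numFieldNormedType.Exports.

Local Open Scope classical_set_scope.
Local Open Scope ring_scope.

Inductive species := A | B | C.

Definition species_to_ord (a : species) : 'I_3 :=
  match a with
    A => @Ordinal 3 0 isT | B => @Ordinal 3 1 isT | C => @Ordinal 3 2 isT end.

Definition ord_to_species (i : 'I_3) : species :=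
  match val i with 0%N => A | 1%N => B | _ => C end.

Lemma species_to_ordK : cancel species_to_ord ord_to_species.
Proof. by case. Qed.

HB.instance Definition _ := Equality.copy species (can_type species_to_ordK).
HB.instance Definition _ := Choice.copy species (can_type species_to_ordK).
HB.instance Definition _ := Countable.copy species (can_type species_to_ordK).
HB.instance Definition _ := Finite.copy species (can_type species_to_ordK).

(* The ring {-N, ..., N} with indices modulo 2N+1: a site is represented by its
   residue in {0, ..., 2N}, and + and - on this type are modulo 2N+1. *)
Notation site N := 'I_(N.*2.+1).

Section Configurations.
Variables (N : nat) (n : species -> nat).

Definition has_counts (w : {ffun site N -> species}) : bool :=
  [forall a, #|[pred i | w i == a]| == n a].

Record config := Config {
  config_val :> {ffun site N -> species};
  _ : has_counts config_val }.

HB.instance Definition _ := [isSub for config_val].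
HB.instance Definition _ := [Finite of config by <:].

Lemma exchange_subproof (i j : site N) (w : config) :
  has_counts [ffun l => w (tperm i j l)].
Proof.
apply/forallP => a; have /forallP/(_ a)/eqP <- := valP w.
rewrite -!sum1_card [X in _ == X](reindex_inj (@perm_inj _ (tperm i j))) /=.
by apply/eqP/eq_bigl => l; rewrite !inE ffunE.
Qed.

(* sigma^{i,j} w *)
Definition exchange (i j : site N) (w : config) : config :=
  Config (exchange_subproof i j w).

Definition segregated0 : {ffun site N -> species} :=
  [ffun j : site N => if (j < n A)%N then A
                      else if (j < n A + n B)%N then B else C].

Hypothesis n_total : (n A + n B + n C = N.*2.+1)%N.

Lemma segregated_subproof (k : site N) :
  has_counts [ffun i => segregated0 (i - k)].
Proof.
apply/forallP => a; rewrite -sum1_card (reindex_inj (addIr k)) /=.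
rewrite (eq_bigl (fun j : site N => (if (j < n A)%N then A
    else if (j < n A + n B)%N then B else C) == a)); last first.
  by move=> j; rewrite !inE !ffunE addrK.
rewrite -(big_mkord (fun j => (if (j < n A)%N then A
    else if (j < n A + n B)%N then B else C) == a) (fun=> 1%N)) -n_total.
rewrite (@big_cat_nat _ _ _ (n A)) /= -?addnA ?leq_addr // addnA.
rewrite (@big_cat_nat _ _ _ (n A + n B) (n A)) /= ?leq_addr //.
have count c p q : (p <= q)%N ->
    (forall j, (p <= j < q)%N -> (if (j < n A)%N then A
       else if (j < n A + n B)%N then B else C) = c) ->
    (\sum_(p <= j < q | (if (j < n A)%N then A
       else if (j < n A + n B)%N then B else C) == a) 1 =
     (c == a) * (q - p))%N.
  move=> pq H; rewrite big_nat_cond (eq_bigl (fun j => (p <= j < q)%N && (c == a))).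
    rewrite -big_nat_cond; case: (c == a); last by rewrite big_pred0.
    by rewrite sum_nat_const_nat muln1 mul1n.
  by move=> j; case: (boolP (p <= j < q)%N) => //= /H ->.
rewrite (count A 0%N) ?(count B (n A)) ?(count C (n A + n B)%N) ?leq_addr //.
- by case: a {count}; rewrite /= ?mul1n ?mul0n ?addn0 ?add0n ?subn0 ?addKn.
- by move=> j /andP[h _]; rewrite !ltnNge h (leq_trans (leq_addr _ _) h).
- by move=> j /andP[h1 h2]; rewrite ltnNge h1 h2.
- by move=> j /andP[_ ->].
Qed.

(* omega_k = Theta^k omega_0 *)
Definition segregated (k : site N) : config := Config (segregated_subproof k).

Definition Omega0 : set config := range segregated.

End Configurations.

Section ContinuousTimeChains.
Variables (R : realType) (X : finType).

Definition is_transition_semigroup (p : R -> X -> X -> R) : Prop :=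
  [/\ forall t x y, 0 <= t -> 0 <= p t x y,
      forall t x, 0 <= t -> \sum_y p t x y = 1,
      forall x y, p 0 x y = (x == y)%:R &
      forall s t x y, 0 <= s -> 0 <= t ->
        p (s + t) x y = \sum_z p s x z * p t z y].

Definition has_generator (p : R -> X -> X -> R) (L : (X -> R) -> X -> R) :
    Prop :=
  forall (f : X -> R) (x : X),
    h^-1 * ((\sum_y p h x y * f y) - f x) @[h --> 0^'+] --> L f x.

Variables (d : measure_display) (T : measurableType d) (P : probability T R).

(* Cadlag for the discrete topology on X. *)
Definition cadlag_path (path : R -> X) : Prop :=
  (forall t, 0 <= t -> \forall s \near t^'+, path s = path t) /\
  (forall t, 0 < t -> exists x, \forall s \near t^'-, path s = x).

Definition markov_property (p : R -> X -> X -> R) (eta : R -> T -> X) : Prop :=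
  forall (m : nat) (t : nat -> R) (x : nat -> X),
    0 <= t 0%N -> (forall i, t i <= t i.+1) ->
    P [set w | forall i, (i <= m.+1)%N -> eta (t i) w = x i] =
    (P [set w | forall i, (i <= m)%N -> eta (t i) w = x i] *
     (p (t m.+1 - t m) (x m) (x m.+1))%:E)%E.

(* Only the values of eta at nonnegative times matter. *)
Definition is_markov_chain (L : (X -> R) -> X -> R) (x0 : X)
    (eta : R -> T -> X) : Prop :=
  [/\ forall t x, 0 <= t -> measurable (eta t @^-1` [set x]),
      forall w, cadlag_path (eta^~ w),
      P (eta 0 @^-1` [set x0]) = 1%E &
      exists p, [/\ is_transition_semigroup p, has_generator p L &
                    markov_property p eta]].

End ContinuousTimeChains.

Section ABC.
Variables (R : realType) (N : nat) (n : species -> nat).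

Definition jump_rate (beta : R) (k : site N) (w : config N n) : R :=
  if (w k, w (ordS k)) \in [:: (A, B); (B, C); (C, A)]
  then expR (- beta) else 1.

Definition ABC_generator (beta : R) (f : config N n -> R) (w : config N n) : R :=
  \sum_(k : site N)
    jump_rate beta k w * (f (exchange k (ordS k) w) - f w).

End ABC.

(* Main.v *)
Require Import Defs.
From mathcomp Require Import all_boot all_order all_fingroup all_algebra.
From mathcomp Require Import all_classical all_reals all_analysis.
From mathcomp Require Import measurable_realfun.
From mathcomp Require Import zify ring lra.

Set Implicit Arguments.
Unset Strict Implicit.
Unset Printing Implicit Defensive.

Import Order.TTheory GRing.Theory Num.Theory.
Import numFieldNormedType.Exports.

Local Open Scope classical_set_scope.
Local Open Scope ring_scope.

(** The idea. Write q for exp(-beta). An exchange that breaks one of the ordered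
pairs AB, BC, CA has rate q; every other exchange of distinct particles puts
such a pair in order and has rate 1. Call the former bonds _up_, the latter
_down_. When the three populations differ there is no explicit invariant
measure, and the proof rests instead on a function of configurations, [height],
which the generator decreases away from the segregated configurations.

A configuration is read as a cyclic word and, when it is close to a segregated
one, lifted to a word in 0, 1, 2, 3, where 0 and 3 both stand for A. Its
_level_ is the number of inversions of such a lift; level 0 is segregated.
As long as the level is at most M = min(n A, n B, n C), an exchange across an
up bond raises the level by one, an exchange across a down bond lowers it by one
([level_step]), a down bond exists unless the level is 0 ([level_down]), and up
bonds outnumber down bonds by at most 3 ([level_ups]). With the value K x^h at
level h, a climb gains about K x^(h+1) at rate q and a fall loses about K x^h at
rate 1, so that the drift is nonpositive as soon as 4 q x <= 1.

The only configurations of level M from which a fall leads elsewhere are the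
_gates_: a particle of one species and a particle of another have met, in the
wrong order, inside the block of the third. From a gate the chain falls either
into a _flat_ stretch, where the two particles return to the boundaries of the
block in at most as many falls as it has particles, or into a _trap_: the two
particles have exchanged, the configuration winds twice around the cyclic order
of the species, and no down bond is left. A trap is left at rate q only, to a gate or to a _rim_, a
configuration that falls back into a trap ([trap_step]). All these are given
values of order x^M ([value]), arranged so that each stratum has negative drift,
and every configuration outside the chart gets the cap x^(M+1), which is the
maximum of [height] and thus has nonpositive drift.

At a segregated configuration the drift is at most 3 q K x. Dynkin's inequality
is used with two choices of x. For x = 1/(4q) the drift on the chart is merely
nonpositive, and the mean of [height] shows that at time s the chain is outside
the chart with probability at most K (1 + s) (4q)^(M+1): on the time scale
N^2 exp(M beta) this is of order N^3 4^M q. For x = 1/(8q) the drift on the chart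
is at most -K x / 4 away from the segregated configurations, so that only a
fraction of order q of the time is spent at such places ([occupation_bound]). Both contributions
are at most a constant multiple of N^3 4^Mstar q ([scales_le]).

Dynkin's inequality comes from the transition semigroup along a time grid
([grid_drift]); it passes to the occupation integral because the indicator of a
set along a right-continuous path is the limit of its Riemann sums
([riemann_cvg], [occupation_le]). *)

(** * Configurations as cyclic words *)

Definition nxt (a : species) : species :=
  match a with A => B | B => C | C => A end.

Section Words.
Local Open Scope nat_scope.
Variables (N : nat) (n : species -> nat).
Implicit Types (w : config N n) (s t p q : seq species).

(** A word is read from an arbitrary site: all notions below are invariant under
    rotations of the ring. *)
Definition spells w s : Prop :=
  size s = N.*2.+1 /\
  exists r : nat, forall i, i < N.*2.+1 -> nth A s i = w (inZp (r + i)).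

Lemma inZp_modD m i j : (i = j %[mod m.+1]) -> inZp i = inZp j :> 'I_m.+1.
Proof. by move=> h; apply: val_inj. Qed.

Lemma spells_rot w p q : spells w (p ++ q) -> spells w (q ++ p).
Proof.
case=> sz [r hr]; split; first by rewrite size_cat addnC -size_cat.
exists (r + size p) => i iL; rewrite nth_cat; case: ltnP => iq.
  have := hr (size p + i); rewrite nth_cat ifF ?addKn ?addnA; [apply|];
  by have := sz; rewrite size_cat; lia.
have := hr (i - size q); rewrite nth_cat.
have szpq : size p + size q = N.*2.+1 by rewrite -sz size_cat.
have -> : i - size q < size p by lia.
move=> ->; last by lia.
congr (w _); apply: inZp_modD.
have -> : r + size p + i = r + (i - size q) + (N.*2.+1) by lia.
by rewrite modnDr.
Qed.

Definition word_from w (k : nat) : seq species :=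
  mkseq (fun j => w (inZp (k + j))) N.*2.+1.

Lemma spells_split w s k : spells w s ->
  exists p q, s = p ++ q /\ q ++ p = word_from w k.
Proof.
case=> sz [r hr].
have [i iL ki] : exists2 i, i < N.*2.+1 & r + i = k %[mod N.*2.+1].
  exists ((k + (N.*2.+1 - r %% N.*2.+1)) %% N.*2.+1); first by rewrite ltn_mod.
  have rL : r %% N.*2.+1 < N.*2.+1 by rewrite ltn_mod.
  rewrite modnDmr -modnDml addnCA subnKC ?(ltnW rL) //.
  by rewrite modnDr.
exists (take i s), (drop i s); rewrite cat_take_drop; split=> //.
apply: (@eq_from_nth _ A).
  by rewrite size_mkseq size_cat addnC -size_cat cat_take_drop.
rewrite size_cat size_drop size_take sz iL => j; rewrite subnK ?(ltnW iL)// => jL.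
rewrite nth_mkseq // nth_cat size_drop sz; case: ltnP => jl.
  rewrite nth_drop hr; last by lia.
  by congr (w _); apply: inZp_modD; rewrite addnA -modnDml ki modnDml.
rewrite nth_take; last by lia.
rewrite hr; last by lia.
congr (w _); apply: inZp_modD.
rewrite -[RHS]modnDml -ki modnDml.
have -> : r + i + j = r + (j - (N.*2.+1 - i)) + N.*2.+1 by lia.
by rewrite modnDr.
Qed.

(** A word determines the configuration up to a rotation; this is how a
    configuration is recognised as segregated. *)
Lemma spells_uniq w1 w2 s : spells w1 s -> spells w2 s ->
  exists r : nat, forall i : site N, w1 i = w2 (inZp (i + r)).
Proof.
move=> h1 [sz [r2 h2]]; have [p [q [spq eq1]]] := spells_split 0 h1.
have /spells_rot : spells w2 (p ++ q) by rewrite -spq; split=> //; exists r2.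
rewrite eq1 => -[_ [r h]]; exists r => i.
have := h i (ltn_ord i); rewrite nth_mkseq // add0n valZpK => ->.
by rewrite addnC.
Qed.

Hypothesis N_gt0 : 0 < N.

Lemma ordS_inZp (i : nat) : ordS (inZp i : site N) = inZp i.+1.
Proof. by apply: val_inj; rewrite /= -addn1 modnDml addn1. Qed.

(** Reading from the site k puts the bond (k, k+1) at the head of the word. *)
Lemma exchange_word_from w (k : site N) : exists q,
  word_from w k = w k :: w (ordS k) :: q /\
  spells (exchange k (ordS k) w) (w (ordS k) :: w k :: q).
Proof.
have kE : inZp k = k by rewrite valZpK.
have LE : N.*2.+1 = N.-1.*2.+3 by case: (N) N_gt0.
have kS : ordS k = inZp (k + 1) by rewrite -{1}kE ordS_inZp addn1.
pose q := mkseq (fun j => w (inZp (k + j.+2))) N.-1.*2.+1.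
exists q; have e1 : word_from w k = w k :: w (ordS k) :: q.
  apply: (@eq_from_nth _ A).
    by rewrite {1}/word_from size_mkseq -[size (_ :: _)]/((size q).+2) size_mkseq LE.
  rewrite {1}/word_from size_mkseq => -[|[|i]] iL; rewrite nth_mkseq //.
  - by rewrite addn0 kE.
  - by rewrite kS.
  by rewrite -[nth _ _ _]/(nth A q i) nth_mkseq //; move: iL; rewrite LE.
split=> //; split; first by rewrite -[size (_ :: _)]/((size q).+2) size_mkseq LE.
have neq i : i.+2 < N.*2.+1 ->
    (inZp (k + i.+2) != k :> site N) && (inZp (k + i.+2) != ordS k :> site N).
  move=> iL; apply/andP; split; apply/eqP => /(congr1 val).
    move=> /= /eqP; rewrite -{2}[nat_of_ord k](modn_small (ltn_ord k)).
    by rewrite -{2}[nat_of_ord k]addn0 eqn_modDl mod0n modn_small.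
  rewrite kS => /= /eqP; rewrite eqn_modDl.
  by rewrite [in X in X == _ -> _]modn_small // modn_small //; lia.
exists k => -[|[|i]] iL.
- by rewrite ffunE addn0 kE tpermL.
- by rewrite ffunE -kS tpermR.
rewrite -[nth _ _ _]/(nth A q i) nth_mkseq; last by move: iL; rewrite LE.
rewrite ffunE; case/andP: (neq i iL) => n1 n2.
by rewrite tpermD // eq_sym.
Qed.

(** For a word fixed in advance a bond is either inside the word or at its seam,
    where the last letter meets the first; one cannot rotate the seam away
    without changing the lift of the word. *)
Lemma bond_cases w s (k : site N) : spells w s ->
  (exists p q, s = p ++ w k :: w (ordS k) :: q /\
     spells (exchange k (ordS k) w) (p ++ w (ordS k) :: w k :: q)) \/
  (exists m, s = w (ordS k) :: m ++ [:: w k] /\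
     spells (exchange k (ordS k) w) (w k :: m ++ [:: w (ordS k)])).
Proof.
move=> /(spells_split k)[p [q [-> eqp]]].
have [t [tE tR]] := exchange_word_from w k.
case: q eqp => [|a [|b q]]; rewrite tE /=.
- rewrite cats0 => pE; left; exists [::], t; rewrite pE.
  by split=> //=; rewrite -?pE.
- case=> -> ->; right; exists t; split=> //.
  by have /= := @spells_rot _ [:: _] (_ :: _) tR.
case=> -> -> qp; left; exists p, q; split=> //.
by rewrite -qp in tR; have := @spells_rot _ (_ :: _ :: _) _ tR.
Qed.

Lemma bond_exists w p a b q : spells w (p ++ a :: b :: q) ->
  exists k : site N, [/\ w k = a, w (ordS k) = b &
    spells (exchange k (ordS k) w) (p ++ b :: a :: q)].
Proof.
move=> /spells_rot /= [sz [r hr]]; exists (inZp r).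
have LE : N.*2.+1 = N.-1.*2.+3 by case: (N) N_gt0.
have h0 : w (inZp r) = a by have := hr 0 isT; rewrite addn0 => <-.
have h1 : w (ordS (inZp r)) = b.
  by rewrite ordS_inZp -[r.+1]addn1 -hr // LE.
split=> //; have [t [tE tR]] := exchange_word_from w (inZp r).
rewrite h0 h1 in tE tR.
have [tE'] : a :: b :: t = a :: b :: q ++ p.
  rewrite -tE; apply: (@eq_from_nth _ A); rewrite ?size_mkseq // => i iL.
  rewrite hr // nth_mkseq //; congr (w _); apply: inZp_modD.
  by rewrite /= modnDml.
by rewrite tE' in tR; have := @spells_rot _ (_ :: _ :: _) _ tR.
Qed.

Fixpoint path_sum (f : species -> species -> nat) a s :=
  if s is b :: s' then f a b + path_sum f b s' else 0.

Lemma path_sumE f a s :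
  path_sum f a s = \sum_(i < size s) f (nth A (a :: s) i) (nth A s i).
Proof.
elim: s a => [|b s IH] a /=; first by rewrite big_ord0.
by rewrite big_ord_recl /= IH.
Qed.

Lemma sum_bonds f w a s : spells w (a :: s) ->
  \sum_(k : site N) f (w k) (w (ordS k)) = path_sum f a (rcons s a).
Proof.
case=> sz [r hr]; rewrite path_sumE size_rcons.
have inj : injective (fun i : site N => inZp (r + i) : site N).
  move=> i j /(congr1 val) /= /eqP; rewrite eqn_modDl !modn_small // => /eqP h.
  exact: val_inj.
rewrite (reindex_inj inj) /= -[(size s).+1]/(size (a :: s)) sz.
apply: eq_bigr => i _; rewrite -hr //; congr (f _ _).
  by rewrite -rcons_cons nth_rcons sz ltn_ord.
rewrite ordS_inZp -addnS nth_rcons; case: ltnP => is_.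
  by rewrite -hr // -[X in _ < X]sz.
have -> : nat_of_ord i = size s by have := ltn_ord i; rewrite -{2}sz /=; lia.
rewrite eqxx; have := hr 0 isT => /= ->; congr (w _); apply: inZp_modD.
have -> : (size s).+1 = N.*2.+1 by [].
by rewrite modnDr addn0.
Qed.

End Words.

(** * Inversions of lifted words *)

Section Inversions.
Local Open Scope nat_scope.
Implicit Types (p q l m : seq nat).

Fixpoint inversions l :=
  if l is a :: l' then count (fun b => b < a) l' + inversions l' else 0.

Definition cross p q := sumn [seq count (fun b => b < a) q | a <- p].

Lemma inversions_cat p q :
  inversions (p ++ q) = inversions p + inversions q + cross p q.
Proof.
rewrite /cross; elim: p => [|a p IH] //=; first by rewrite addn0.
by rewrite IH count_cat; lia.
Qed.

Lemma cross_cons p a q :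
  cross p (a :: q) = count (fun b => a < b) p + cross p q.
Proof. by rewrite /cross; elim: p => //= b p ->; lia. Qed.

(** The letters a and b enter symmetrically except in the last term: exchanging
    them changes the number of inversions by one at most. *)
Lemma inversions_split p a b q : inversions (p ++ a :: b :: q) =
  inversions (p ++ q) + count (fun c => a < c) p + count (fun c => b < c) p
  + count (fun c => c < a) q + count (fun c => c < b) q + (b < a).
Proof. by rewrite !inversions_cat !cross_cons /=; lia. Qed.

Lemma inversions_swap p a b q :
  inversions (p ++ b :: a :: q) + (b < a) = inversions (p ++ a :: b :: q) + (a < b).
Proof. by rewrite !inversions_split; lia. Qed.

Lemma descent_exists l : 0 < inversions l ->
  exists p a b q, l = p ++ a :: b :: q /\ b < a.
Proof.
elim: l => // a [|b l] IH //= h; case: (ltnP b a) => ab.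
  by exists [::], a, b, l.
have [|p [c [d [q [-> cd]]]]] := IH; last by exists (a :: p), c, d, q.
have e : (b < a) = false by lia.
move: h; rewrite /= e add0n => h.
have : count (fun c => c < a) l <= count (fun c => c < b) l.
  by apply: sub_count => c /= ca; apply: leq_trans ca ab.
by lia.
Qed.

Fixpoint occ (v : nat) l : nat :=
  if l is a :: l' then (a == v) + occ v l' else 0.

Lemma occ_cat v p q : occ v (p ++ q) = occ v p + occ v q.
Proof. by elim: p => //= a p ->; rewrite addnA. Qed.

(** A lift is a word in 0, 1, 2, 3, with 0 and 3 both standing for A: a segregated
    configuration lifts to a sorted word wherever inside the A block it is cut. *)
Definition lifted l := all (leq^~ 3) l.

Lemma count_lt l : lifted l ->
  [/\ count (fun c => c < 0) l = 0,
      count (fun c => c < 1) l = occ 0 l,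
      count (fun c => c < 2) l = occ 0 l + occ 1 l &
      count (fun c => c < 3) l = occ 0 l + occ 1 l + occ 2 l].
Proof.
elim: l => // a l IH /= /andP[a3 /IH[-> -> -> ->]].
by case: a a3 => [|[|[|[|]]]] //=; split; lia.
Qed.

Lemma count_gt l : lifted l ->
  [/\ count (fun c => 3 < c) l = 0,
      count (fun c => 2 < c) l = occ 3 l,
      count (fun c => 1 < c) l = occ 3 l + occ 2 l &
      count (fun c => 0 < c) l = occ 3 l + occ 2 l + occ 1 l].
Proof.
elim: l => // a l IH /= /andP[a3 /IH[-> -> -> ->]].
by case: a a3 => [|[|[|[|]]]] //=; split; lia.
Qed.

Lemma inversions0_sorted l : lifted l -> inversions l = 0 ->
  l = nseq (occ 0 l) 0 ++ nseq (occ 1 l) 1 ++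
      nseq (occ 2 l) 2 ++ nseq (occ 3 l) 3.
Proof.
elim: l => // a l IH /= /andP[a3 l3] h.
have {IH} := IH l3; have -> : inversions l = 0 by lia.
move=> /(_ erefl) lE; have [h0 h1 h2 h3] := count_lt l3.
case: a a3 h => [|[|[|[|]]]] //= _ h; rewrite {1}lE ?add0n ?add1n //.
- by have -> : occ 0 l = 0 by lia.
- have -> : occ 0 l = 0 by lia.
  by have -> : occ 1 l = 0 by lia.
have -> : occ 0 l = 0 by lia.
have -> : occ 1 l = 0 by lia.
by have -> : occ 2 l = 0 by lia.
Qed.

End Inversions.

(** * Words made of runs *)

Lemma nxt3 a : nxt (nxt (nxt a)) = a.
Proof. by case: a. Qed.

Lemma run_cons (x : species) t : x :: t = nseq 1 x ++ t.
Proof. by []. Qed.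

Lemma run0 (x : species) t : nseq 0 x ++ t = t.
Proof. by []. Qed.

Lemma run_merge (x : species) i j t :
  nseq i x ++ nseq j x ++ t = nseq (i + j)%N x ++ t.
Proof. by rewrite nseqD catA. Qed.

Lemma count_run P (x : species) t : count P (x :: t) = (P x + count P t)%N.
Proof. by []. Qed.

Lemma run_congr (x : species) i j s t :
  i = j -> s = t -> nseq i x ++ s = nseq j x ++ t.
Proof. by move=> -> ->. Qed.

(* Both sides are normalised to a product of runs. Appending the empty word
   first gives the last run the same shape as the others. *)
Ltac runs_eq :=
  rewrite ?nxt3 -[LHS]cats0 -[RHS]cats0;
  rewrite ?run_cons -?catA ?cat0s ?run0 ?run_merge;
  repeat match goal with
  | |- nseq _ _ ++ _ = nseq _ _ ++ _ => apply: run_congr; first by lia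
  end;
  first [reflexivity | rewrite [RHS]cats0; reflexivity].

(** * Levels, flat stretches, gates and traps *)

Definition letter (i : nat) : species :=
  match i with 0%N => A | 1%N => B | 2%N => C | _ => A end.

Section Strata.
Local Open Scope nat_scope.
Variables (N : nat) (n : species -> nat).
Hypothesis N_gt0 : 0 < N.
Hypothesis n_ge3 : forall a, 3 <= n a.
Implicit Types (w : config N n) (s t p q : seq species).

Definition up_bond w (k : site N) := w (ordS k) == nxt (w k).
Definition down_bond w (k : site N) := w k == nxt (w (ordS k)).
Definition swap w (k : site N) := exchange k (ordS k) w.

(** The lift, hence the number h, is not unique in general; the lemmas below hold
    for every choice. *)
Definition level w h :=
  exists l, [/\ lifted l, spells w (map letter l) & inversions l = h].

(** For X, Y, Z in cyclic order this is a segregated configuration in which one X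
    and one Z have entered the Y block, by i and j places, at its two ends; m
    letters Y are left between them. The total excess i + j plays the part of the
    level, even when it is much larger than M. *)
Definition flat_word X i m j := let Y := nxt X in let Z := nxt Y in
  X :: nseq i Y ++ X :: nseq m Y ++ Z :: nseq j Y ++
  nseq (n Z).-1 Z ++ nseq (n X).-2 X.

Definition flat w e := exists X i m j,
  [/\ 0 < m, i + j = e & spells w (flat_word X i m j)].

(** The two intruders X and Z are adjacent, and X Z is a down bond. *)
Definition gate w := exists X i j, spells w (flat_word X i 0 j).

(** A gate after its intruders have exchanged. Read cyclically, the species
    follow each other twice in the order X, Y, Z: every bond is up or neutral. *)
Definition trap_word X i j := let Y := nxt X in let Z := nxt Y in
  X :: nseq i Y ++ Z :: X :: nseq j Y ++ nseq (n Z).-1 Z ++ nseq (n X).-2 X.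

Definition trap w := exists X i j,
  [/\ 0 < i, 0 < j & spells w (trap_word X i j)].

Lemma count_spells w s x : spells w s -> count_mem x s = n x.
Proof.
case: s => [[]//|a s] h; have := sum_bonds N_gt0 (fun a b => (a == x) : nat) h.
have -> b : path_sum (fun c _ : species => c == x) a (rcons s b) =
            count_mem x (a :: s).
  by elim: s a {h} => [|c s IH] a //=; rewrite IH.
move=> <-; have /forallP/(_ x)/eqP <- := valP w.
rewrite -sum1_card [RHS]big_mkcond /=; apply: eq_bigr => i _.
by rewrite inE; case: eqP.
Qed.

Lemma count_lifted w l : lifted l -> spells w (map letter l) ->
  [/\ n A = occ 0 l + occ 3 l, n B = occ 1 l
    & n C = occ 2 l].
Proof.
move=> l3 h; rewrite -(count_spells A h) -(count_spells B h) -(count_spells C h).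
elim: l l3 {h} => // a l IH /= /andP[a3 /IH[-> -> ->]].
by case: a a3 => [|[|[|[|]]]] //=; split; lia.
Qed.

Variable M : nat.
Hypothesis M_min : forall a, M <= n a.

Lemma spells_rotE w s t p q : spells w s -> s = p ++ q -> t = q ++ p -> spells w t.
Proof. by move=> h e ->; apply: spells_rot; rewrite -e. Qed.

(** The sizes of the last two blocks are forced by the populations, so that a
    configuration is recognised as flat without computing them. *)
Lemma flat_spells w X i m j c d :
  spells w (nseq i (nxt X) ++ X :: nseq m (nxt X) ++ nxt (nxt X) ::
         nseq j (nxt X) ++ nseq c (nxt (nxt X)) ++ nseq d X) ->
  spells w (flat_word X i m j).
Proof.
move=> rw; have := count_spells X rw; have := count_spells (nxt (nxt X)) rw.
have := n_ge3 X; have := n_ge3 (nxt (nxt X)).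
rewrite !(count_cat, count_nseq, count_run) => H H0 H1 H2.
have {H1} H1 : n (nxt (nxt X)) = c.+1 by case: X {rw H H0} H1 H2 => /=; lia.
have {H2} H2 : n X = d.+1 by case: X {rw H H0} H1 H2 => /=; lia.
apply: (spells_rotE
  (p := nseq i (nxt X) ++ X :: nseq m (nxt X) ++ nxt (nxt X) ::
        nseq j (nxt X) ++ nseq c (nxt (nxt X)) ++ nseq d.-1 X) (q := [:: X]) rw).
  by runs_eq.
by rewrite /flat_word H1 H2; runs_eq.
Qed.

Lemma gate_intro w X i j c d :
  spells w (nseq i (nxt X) ++ X :: nxt (nxt X) :: nseq j (nxt X) ++
         nseq c (nxt (nxt X)) ++ nseq d X) -> gate w.
Proof. by move=> /(flat_spells (m := 0)) h; exists X, i, j. Qed.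

Lemma flat_intro w X i m j c d e :
  spells w (nseq i (nxt X) ++ X :: nseq m (nxt X) ++ nxt (nxt X) ::
         nseq j (nxt X) ++ nseq c (nxt (nxt X)) ++ nseq d X) ->
  0 < m -> i + j = e -> flat w e.
Proof. by move=> /flat_spells h m0; exists X, i, m, j. Qed.

Lemma trap_intro w X i j c d :
  spells w (nseq i (nxt X) ++ nxt (nxt X) :: X :: nseq j (nxt X) ++
         nseq c (nxt (nxt X)) ++ nseq d X) -> 0 < i -> 0 < j -> trap w.
Proof.
move=> rw i0 j0; have := count_spells X rw; have := count_spells (nxt (nxt X)) rw.
have := n_ge3 X; have := n_ge3 (nxt (nxt X)).
rewrite !(count_cat, count_nseq, count_run) => H H0 H1 H2.
have {H1} H1 : n (nxt (nxt X)) = c.+1 by case: X {rw H H0} H1 H2 => /=; lia.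
have {H2} H2 : n X = d.+1 by case: X {rw H H0} H1 H2 => /=; lia.
exists X, i, j; split=> //; apply: (spells_rotE
  (p := nseq i (nxt X) ++ nxt (nxt X) :: X ::
        nseq j (nxt X) ++ nseq c (nxt (nxt X)) ++ nseq d.-1 X) (q := [:: X]) rw).
  by runs_eq.
by rewrite /trap_word H1 H2; runs_eq.
Qed.

(** If a skipped over the letter c with b < c < a, each of the at least M particles
    of the species of c would be inverted with a or with b, besides the inversion
    of a and b themselves. *)
Lemma inversions_adjacent w (p : seq nat) (a b : nat) (q : seq nat) :
  lifted (p ++ a :: b :: q) ->
  spells w (map letter (p ++ a :: b :: q)) -> inversions (p ++ a :: b :: q) <= M ->
  a <= b.+1.
Proof.
move=> l3 /(count_lifted l3)[].
move: l3; rewrite inversions_split /lifted !all_cat /= => /and4P[p3 a3 b3 q3].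
have [L0 L1 L2 L3] := count_lt q3; have [G3 G2 G1 G0] := count_gt p3.
have := M_min A; have := M_min B; have := M_min C; rewrite !occ_cat /=.
by case: a a3 => [|[|[|[|]]]] //= _; case: b b3 => [|[|[|[|]]]] //= _;
  rewrite ?L0 ?L1 ?L2 ?L3 ?G0 ?G1 ?G2 ?G3; lia.
Qed.

(** Along the lift a down bond need not be an inversion: 0 2 and 1 3 are down
    bonds as well, since A follows C and B follows A. Then every particle of the
    intermediate species is inverted with one of the two, which already makes M
    inversions; so there are no others and the word is that of a gate. *)
Lemma level_step_inner w w' (p : seq nat) (a b : nat) (q : seq nat) :
  lifted (p ++ a :: b :: q) ->
  spells w (map letter (p ++ a :: b :: q)) ->
  spells w' (map letter (p ++ b :: a :: q)) ->
  inversions (p ++ a :: b :: q) <= M ->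
  (letter b = nxt (letter a) -> level w' (inversions (p ++ a :: b :: q)).+1) /\
  (letter a = nxt (letter b) ->
     (0 < inversions (p ++ a :: b :: q) /\ level w' (inversions (p ++ a :: b :: q)).-1) \/
     (inversions (p ++ a :: b :: q) = M /\ gate w)).
Proof.
move=> l3 rw rw' hM.
have l3' : lifted (p ++ b :: a :: q).
  by move: l3; rewrite /lifted !all_cat /= => /and4P[-> -> -> ->].
have ab := inversions_adjacent l3 rw hM; have sw := inversions_swap p a b q.
have lev h : inversions (p ++ b :: a :: q) = h -> level w' h.
  by move=> <-; exists (p ++ b :: a :: q).
have [cA cB cC] := count_lifted l3 rw.
move: (l3); rewrite /lifted all_cat /= => /and4P[p3 a3 b3 q3].
split.
  move=> e; apply: lev.
  by case: a b a3 b3 e ab sw {l3 rw rw' hM l3' cA cB cC}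
    => [|[|[|[|]]]] // [|[|[|[|]]]] //=; lia.
move=> e; have [lt_ba|le_ab] := ltnP b a.
  left; split; last apply: lev; move: sw; rewrite lt_ba [a < b]ltnNge (ltnW lt_ba) /=; lia.
right.
have : (a = 0 /\ b = 2) \/ (a = 1 /\ b = 3).
  by case: a b a3 b3 e le_ab {l3 rw rw' hM l3' ab sw cA cB cC lev}
    => [|[|[|[|]]]] // [|[|[|[|]]]] //=; lia.
have q3' : lifted q by []. have p3' : lifted p by [].
have [L0 L1 L2 L3] := count_lt q3'; have [G3 G2 G1 G0] := count_gt p3'.
have MA := M_min A; have MB := M_min B; have MC := M_min C.
move: hM cA cB cC; rewrite inversions_split inversions_cat !occ_cat => hM cA cB cC.
case=> -[? ?]; subst a b;
  rewrite /= ?L0 ?L2 ?L1 ?L3 ?G0 ?G1 ?G2 ?G3 in hM cA cB cC *; split; try lia.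
- have ip : inversions p = 0 by lia.
  have iq : inversions q = 0 by lia.
  move: rw; rewrite (inversions0_sorted p3' ip) (inversions0_sorted q3' iq).
  have -> : occ 2 p = 0 by lia.
  have -> : occ 3 p = 0 by lia.
  have -> : occ 0 q = 0 by lia.
  rewrite /= !cats0 !map_cat /= !map_cat !map_nseq /= => rw.
  apply: (@gate_intro w A (occ 1 p) (occ 1 q) (occ 2 q)
            (occ 3 q + occ 0 p)).
  apply: (spells_rotE (p := nseq (occ 0 p) A) rw); first by runs_eq.
  by runs_eq.
- have ip : inversions p = 0 by lia.
  have iq : inversions q = 0 by lia.
  move: rw; rewrite (inversions0_sorted p3' ip) (inversions0_sorted q3' iq).
  have -> : occ 3 p = 0 by lia.
  have -> : occ 0 q = 0 by lia.
  have -> : occ 1 q = 0 by lia.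
  rewrite /= !cats0 !map_cat /= !map_cat !map_nseq /= => rw.
  apply: (@gate_intro w B (occ 2 p) (occ 2 q)
            (occ 3 q + occ 0 p) (occ 1 p)).
  apply: (spells_rotE (p := nseq (occ 0 p) A ++ nseq (occ 1 p) B) rw);
    first by runs_eq.
  by runs_eq.
Qed.

End Strata.

(** * One exchange changes the level by one *)

Section Levels.
Local Open Scope nat_scope.
Variables (N : nat) (n : species -> nat).
Hypothesis N_gt0 : 0 < N.
Hypothesis n_ge3 : forall a, 3 <= n a.
Variable M : nat.
Hypothesis M_min : forall a, M <= n a.
Implicit Types (w : config N n).

Lemma map_letter_split l p a b q : map letter l = p ++ a :: b :: q ->
  exists p1 a1 b1 q1, [/\ l = p1 ++ a1 :: b1 :: q1, p = map letter p1,
    a = letter a1, b = letter b1 & q = map letter q1].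
Proof.
elim: p l => [|c p IH] [|d l] //=.
  by case: l => // d' l [<- <- <-]; exists [::], d, d', l.
move=> [<-] /IH[p1 [a1 [b1 [q1 [-> -> -> -> ->]]]]].
by exists (d :: p1), a1, b1, q1.
Qed.

Lemma inversions_rot0 m : inversions (0 :: m) = inversions m.
Proof.
have -> : inversions (0 :: m) = count (fun c => c < 0) m + inversions m by [].
by elim: m => [|a m IH] //=; lia.
Qed.

Lemma inversions_rot3 m : lifted m -> inversions (m ++ [:: 3]) = inversions m.
Proof.
move=> m3; rewrite inversions_cat cross_cons /=.
by have [-> _ _ _] := count_gt m3; rewrite /cross; elim: {m3} m => //= *; lia.
Qed.

Lemma inversions_ends a m b : inversions (a :: m ++ [:: b]) =
  inversions m + count (fun c => c < a) m + count (fun c => b < c) m + (b < a).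
Proof.
rewrite /= inversions_cat count_cat cross_cons /cross /=.
have -> : sumn [seq 0 | _ <- m] = 0 by elim: m => //=; lia.
lia.
Qed.

(** A bond at the seam moves inside by a rotation when the word begins with 0,
    which may be moved to the end as a 3, or ends with 3, which may be moved to
    the front as a 0. Among the remaining seams only 2 followed by 1 admits at most
    M inversions; each A is then inverted with one of these two letters, and the
    word is again that of a gate. *)
Lemma level_step w k h : level w h -> h <= M ->
  (up_bond w k -> level (swap w k) h.+1) /\
  (down_bond w k -> (0 < h /\ level (swap w k) h.-1) \/ (h = M /\ gate w)).
Proof.
case=> l [l3 rw lh] hM; rewrite /up_bond /down_bond /swap.
have inner w' p a b q : lifted (p ++ a :: b :: q) ->
    spells w (map letter (p ++ a :: b :: q)) ->
    spells w' (map letter (p ++ b :: a :: q)) ->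
    inversions (p ++ a :: b :: q) = h ->
  (letter b == nxt (letter a) -> level w' h.+1) /\
  (letter a == nxt (letter b) -> (0 < h /\ level w' h.-1) \/ (h = M /\ gate w)).
  move=> l3' rw1 rw2 e.
  have := level_step_inner N_gt0 n_ge3 M_min l3' rw1 rw2; rewrite e.
  by move=> /(_ hM)[h1 h2]; split=> /eqP; [apply: h1|apply: h2].
have [] := bond_cases N_gt0 k rw; move: (exchange k (ordS k) w) (w k) (w (ordS k)).
  move=> w' a b [p [q [lE rw']]].
  have [p1 [a1 [b1 [q1 [e1 e2 e3 e4 e5]]]]] := map_letter_split lE.
  rewrite e3 e4; apply: (inner _ p1 a1 b1 q1); rewrite -?e1 //.
  by rewrite map_cat /= -e2 -e3 -e4 -e5.
move=> w' a b [m [lE rw']].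
have [b1 [m1 [a1 [e1 e2 e3 e4]]]] : exists b1 m1 a1,
    [/\ l = b1 :: m1 ++ [:: a1], m = map letter m1, a = letter a1 & b = letter b1].
  case: l lE {l3 rw lh} => [|b1 l] //= [<-]; case/lastP: l => [|l a1].
    by case: (m).
  rewrite map_rcons -cats1 !cats1 => /rcons_inj[<- <-].
  by exists b1, l, a1; rewrite cats1.
subst l m a b; rewrite /= map_cat /= in rw.
have [b3 m3 a3] : [/\ b1 <= 3, lifted m1 & a1 <= 3].
  by move: l3; rewrite /lifted /= all_cat /= => /and4P[-> -> ->].
have [b0|b0] := eqVneq b1 0.
  subst b1; apply: (inner _ m1 a1 3 [::]).
  - by move: m3; rewrite /lifted all_cat /= a3 => ->.
  - by rewrite map_cat /=; have := @spells_rot _ _ _ [:: _] _ rw; rewrite -catA.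
  - rewrite map_cat /=; have := @spells_rot _ _ _ [:: _] _ rw'.
    by rewrite -catA.
  - have e : lifted (m1 ++ [:: a1]).
      by move: m3; rewrite /lifted all_cat /= a3 => ->.
    by rewrite -lh inversions_rot0 -(inversions_rot3 e) -catA.
have [a30|a30] := eqVneq a1 3.
  subst a1; have := inner w' [::] 0 b1 m1; apply.
  - by rewrite /lifted /= b3.
  - by rewrite /=; have := @spells_rot _ _ _ (_ :: _) _ rw.
  - by rewrite /=; have := @spells_rot _ _ _ (_ :: _) _ rw'.
  - by rewrite -lh -cat_cons inversions_rot3 ?inversions_rot0 // /lifted /= b3.
have [L0 L1 L2 L3] := count_lt m3; have [G3 G2 G1 G0] := count_gt m3.
have := count_lifted N_gt0 l3; rewrite map_cons map_cat /= => /(_ _ _ rw).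
rewrite !occ_cat /= => -[cA cB cC].
have MA := M_min A; have MB := M_min B; have MC := M_min C.
move: lh; rewrite inversions_ends.
case: b1 b3 b0 rw rw' cA cB cC {l3 lE inner} => [|[|[|[|]]]] //= _ _ rw rw';
case: a1 a3 a30 rw rw' => [|[|[|[|]]]] //= _ _ rw rw' cA cB cC;
  rewrite ?L0 ?L1 ?L2 ?L3 ?G0 ?G1 ?G2 ?G3 => lh; try lia.
split=> // _; right; split; first by lia.
have im : inversions m1 = 0 by lia.
move: rw; rewrite (inversions0_sorted m3 im) !map_cat !map_nseq /= => rw.
apply: (@gate_intro _ _ N_gt0 n_ge3 w C (occ 3 m1) (occ 0 m1) (occ 1 m1)
         (occ 2 m1)).
apply: (spells_rotE (p := B :: nseq (occ 0 m1) A ++ nseq (occ 1 m1) B ++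
   nseq (occ 2 m1) C) (q := nseq (occ 3 m1) A ++ [:: C]) rw); by runs_eq.
Qed.

(** The species determine each increment of the lift modulo 3, and the increment
    is at least -1: it is at least 1 at an up bond, at least -1 at a down bond and
    at least 0 elsewhere. The total increment is at most 3. *)
Lemma path_lift a l b : lifted (a :: l) -> path (fun c d => c <= d.+1) a l ->
  path_sum (fun x y => y == nxt x) (letter a) (rcons (map letter l) (letter b)) + a <=
  path_sum (fun x y => x == nxt y) (letter a) (rcons (map letter l) (letter b)) + b + 3.
Proof.
elim: l a => [|c l IH] a; rewrite /lifted /=.
  by case: a b => [|[|[|[|]]]] // [|[|[|[|b]]]] //= *; lia.
move=> /and3P[a3 c3 l3] /andP[ac] /IH h; have {h} := h; rewrite /lifted /= c3 l3.
move=> /(_ isT).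
have : (letter c == nxt (letter a)) + a <= (letter a == nxt (letter c)) + c.
  by case: a c a3 c3 ac => [|[|[|[|]]]] // [|[|[|[|]]]].
lia.
Qed.

Definition ups w := \sum_(k : site N) (up_bond w k : nat).
Definition downs w := \sum_(k : site N) (down_bond w k : nat).

Lemma level_ups w h : level w h -> h <= M -> ups w <= downs w + 3.
Proof.
case=> l [l3 rw lh] hM; case: l l3 rw lh => [|a l] l3 rw lh; first by case: rw.
have adj : path (fun c d => c <= d.+1) a l.
  have : forall p q, a :: l = p ++ q -> path (fun c d => c <= d.+1) (head 0 q) (behead q).
    move=> p q; elim: q p => [|c [|d q] IH] p //= e.
    have := IH (p ++ [:: c]); rewrite -catA /= => /(_ e) ->; rewrite andbT.
    move: l3 rw lh; rewrite e => l3 rw lh.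
    by apply: (inversions_adjacent N_gt0 M_min l3 rw); rewrite lh.
  by move=> /(_ [::] (a :: l) erefl).
rewrite /ups /downs (sum_bonds N_gt0 (fun x y => (y == nxt x) : nat) rw).
rewrite (sum_bonds N_gt0 (fun x y => (x == nxt y) : nat) rw).
by rewrite -(leq_add2r a) addnAC; exact: path_lift.
Qed.

(** Below level M an inversion of adjacent letters has difference one, and is
    thus a down bond. *)
Lemma level_down w h : level w h.+1 -> h < M -> exists k, down_bond w k.
Proof.
case=> l [l3 rw lh] hM.
have [|p [a [b [q [lE ab]]]]] := @descent_exists l; first by rewrite lh.
move: l3 rw lh; rewrite lE => l3 rw lh.
have := inversions_adjacent N_gt0 M_min l3 rw; rewrite lh => /(_ hM) ba.
move: rw; rewrite map_cat /= => /(bond_exists N_gt0)[k [wk wk1 _]].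
exists k; rewrite /down_bond wk wk1.
move: l3; rewrite /lifted all_cat /= => /and4P[_ a3 b3 _].
by case: a b a3 b3 ab ba {lE lh wk wk1} => [|[|[|[|]]]] // [|[|[|[|]]]].
Qed.

End Levels.

(** * Locating a bond in a word of runs *)

Section Bonds.
Implicit Types (p q s t : seq species) (a b x y : species).

Lemma split_cons p a b q y t : y :: t = p ++ a :: b :: q ->
  (p = [::] /\ a = y /\ t = b :: q) \/
  (exists p', p = y :: p' /\ t = p' ++ a :: b :: q).
Proof.
case: p => [[-> ->]|c p [-> ->]]; first by left.
by right; exists p.
Qed.

(** A bond in a product of runs lies inside the first run, and is then neutral, at
    the end of that run, or further on. *)
Lemma split_nseq i p a b q y t : nseq i y ++ t = p ++ a :: b :: q ->
  a = b \/
  (exists i', i = i'.+1 /\ p = nseq i' y /\ a = y /\ t = b :: q) \/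
  (exists p', p = nseq i y ++ p' /\ t = p' ++ a :: b :: q).
Proof.
elim: i p => [|i IH] p; first by right; right; exists p.
case: p => [|c p] /=.
  case=> <-; case: i IH => [|i] _ /=; first by right; left; exists 0.
  by case=> <-; left.
case=> <- /IH[->|[[i' [-> [-> [-> ->]]]]|[p' [-> ->]]]]; first by left.
  by right; left; exists i'.+1.
by right; right; exists p'.
Qed.

Lemma head_nseq i y t b q : nseq i y ++ t = b :: q ->
  (exists i', i = i'.+1 /\ b = y /\ q = nseq i' y ++ t) \/
  (i = 0 /\ t = b :: q).
Proof.
case: i => [|i] /=; first by right.
by case=> <- <-; left; exists i.
Qed.

End Bonds.

(* Letters are compared by running through the species; every other equation
   is used to eliminate a variable. *)
Ltac absurd_letters :=
  exfalso;
  repeat match goal with h : @eq species _ _ |- _ => revert h end;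
  clear; repeat match goal with x : species |- _ => case: x end;
  intros; discriminate.

Ltac subst_runs :=
  repeat match goal with
  | h : @eq ?T ?x ?y |- _ =>
    lazymatch T with
    | species => fail
    | _ => first [is_var x; subst x | is_var y; subst y]
    end
  end.

(* [head_split] determines the first letter of a product of runs and [bond_split]
   all the places where a bond can occur in it, leaving one goal for each. *)
Ltac head_split e :=
  lazymatch type of e with
  | nseq _ _ ++ _ = _ =>
     case: (head_nseq e) => {e} [[? [? [? ?]]]|[? e]];
     [subst_runs|subst_runs; head_split e]
  | _ :: _ = _ => case: e => ? ?; subst_runs
  | [::] = _ => discriminate e
  end.

Ltac bond_split e :=
  lazymatch type of e with
  | nseq _ _ ++ _ = _ =>
     case: (split_nseq e) => {e} [?|[[? [? [? [? e]]]]|[? [? e]]]];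
     [|subst_runs; head_split e|subst_runs; bond_split e]
  | _ :: _ = _ =>
     case: (split_cons e) => {e} [[? [? e]]|[? [? e]]];
     [subst_runs; head_split e|subst_runs; bond_split e]
  | [::] = ?p ++ _ => by case: (p) e
  end.

(* The subword p0 is moved from the front of the word to its end. *)
Ltac rotate p0 rw := try unfold flat_word, trap_word in rw;
  eapply (spells_rotE (p := p0) rw); [runs_eq|runs_eq].

(** * Exchanges in flat stretches and gates *)

Section Families.
Local Open Scope nat_scope.
Variables (N : nat) (n : species -> nat).
Hypothesis N_gt0 : 0 < N.
Hypothesis n_ge3 : forall a, 3 <= n a.
Implicit Types (w : config N n).

Lemma bond_inner w (s : seq species) (k : site N) : spells w s ->
  w k <> last A s \/ w (ordS k) <> head A s ->
  exists p q, s = p ++ w k :: w (ordS k) :: q /\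
    spells (swap w k) (p ++ w (ordS k) :: w k :: q).
Proof.
move=> /(bond_cases N_gt0 k)[//|[m [-> _]]].
by rewrite /= last_cat /=; case.
Qed.

Lemma last_run (x y : species) i : 0 < i -> last x (nseq i y) = y.
Proof. by case: i => //= i _; elim: i. Qed.

(** The side condition says that the bond at the seam is not down. *)
Lemma down_inner w (s : seq species) (k : site N) : spells w s -> down_bond w k ->
  last A s <> nxt (head A s) ->
  exists p b q, s = p ++ nxt b :: b :: q /\ spells (swap w k) (p ++ b :: nxt b :: q).
Proof.
move=> rw /eqP dk hl; have [] := @bond_inner w s k rw.
  move: dk hl; case: (w k) (w (ordS k)) (last A s) (head A s) => [] [] [] [] //=;
    by [left|right].
by move=> p [q []]; rewrite dk => *; exists p, (w (ordS k)), q.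
Qed.

Lemma up_inner w (s : seq species) (k : site N) : spells w s -> up_bond w k ->
  head A s <> nxt (last A s) ->
  exists p a q, s = p ++ a :: nxt a :: q /\ spells (swap w k) (p ++ nxt a :: a :: q).
Proof.
move=> rw /eqP dk hl; have [] := @bond_inner w s k rw.
  move: dk hl; case: (w k) (w (ordS k)) (last A s) (head A s) => [] [] [] [] //=;
    by [left|right].
by move=> p [q []]; rewrite dk => *; exists p, (w k), q.
Qed.

Lemma last_flat X i m j : last A (flat_word n X i m j) = X.
Proof.
have d : 0 < (n X).-2 by have := n_ge3 X; lia.
by rewrite /flat_word /= !(last_cat, last_cons) (last_run _ _ d).
Qed.

(** The only down bonds are Y X on the left of the intruder X, Z Y on the right of
    the intruder Z, and X Z between them when m = 0. *)
Lemma flat_step w X i m j (k : site N) : spells w (flat_word n X i m j) ->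
  down_bond w k ->
  (0 < i + j /\ flat (swap w k) (i + j).-1) \/
  (m = 0 /\ spells (swap w k) (X :: nseq i (nxt X) ++ nxt (nxt X) :: X ::
     nseq j (nxt X) ++ nseq (n (nxt (nxt X))).-1 (nxt (nxt X)) ++
     nseq (n X).-2 X)).
Proof.
move=> rw dk; have [] := down_inner rw dk.
  by rewrite last_flat; case: (X).
move=> p [b [q [e rw']]].
rewrite /flat_word -[LHS]cats0 in e; repeat rewrite ?cat_cons -?catA in e.
have [d0 c0] : 0 < (n X).-2 /\ 1 < (n (nxt (nxt X))).-1.
  by have := n_ge3 (nxt (nxt X)); have := n_ge3 X; lia.
move: (n X).-2 (n (nxt (nxt X))).-1 d0 c0 e => d c d0 c0 e {rw dk}.
bond_split e; try absurd_letters; subst b.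
- match goal with |- context [(?x.+1 + j).-1] => rename x into i end.
  left; split; first by lia.
  apply: (@flat_intro _ _ N_gt0 n_ge3 _ X i m.+1 j c d.+1) => //; try lia.
  by rotate [:: X] rw'.
- by right; split=> //; rotate (@nil species) rw'.
- match goal with |- context [(i + ?x.+1).-1] => rename x into j end.
  left; split; first by lia.
  apply: (@flat_intro _ _ N_gt0 n_ge3 _ X i m.+1 j c d.+1) => //; try lia.
  by rotate [:: X] rw'.
- by lia.
Qed.

Lemma count_flat w X i m j : spells w (flat_word n X i m j) ->
  i + m + j = n (nxt X).
Proof.
move=> /(count_spells N_gt0 (nxt X)); rewrite /flat_word.
rewrite !(count_cat, count_nseq, count_run) => <-.
by case: X => /=; lia.
Qed.

Lemma flat_down w e : flat w e -> 0 < e -> exists k, down_bond w k.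
Proof.
move=> [X [i [m [j [m0 <- rw]]]]] ij; case: i ij rw => [|i] ij rw; last first.
  have [|k [wk wk1 _]] := @bond_exists _ _ N_gt0 w (X :: nseq i (nxt X)) (nxt X) X
    (nseq m (nxt X) ++ nxt (nxt X) :: nseq j (nxt X) ++
     nseq (n (nxt (nxt X))).-1 (nxt (nxt X)) ++ nseq (n X).-2 X).
    by rotate (@nil species) rw.
  by exists k; rewrite /down_bond wk wk1.
case: j ij rw => // j _ rw.
have [|k [wk wk1 _]] := @bond_exists _ _ N_gt0 w (X :: X :: nseq m (nxt X))
    (nxt (nxt X)) (nxt X) (nseq j (nxt X) ++
     nseq (n (nxt (nxt X))).-1 (nxt (nxt X)) ++ nseq (n X).-2 X).
  by rotate (@nil species) rw.
by exists k; rewrite /down_bond wk wk1.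
Qed.

(** Since the Y block has at least three particles, one of the two intruders can
    step back towards its own block. *)
Lemma gate_down w : gate w -> exists k e, down_bond w k /\ flat (swap w k) e.
Proof.
move=> [X [i [j rw]]]; have := count_flat rw; have := n_ge3 (nxt X).
case: i rw => [|i] rw n3 ij; last first.
  have [|k [wk wk1 rw']] := @bond_exists _ _ N_gt0 w (X :: nseq i (nxt X)) (nxt X) X
    (nxt (nxt X) :: nseq j (nxt X) ++
     nseq (n (nxt (nxt X))).-1 (nxt (nxt X)) ++ nseq (n X).-2 X).
    by rotate (@nil species) rw.
  exists k, (i + j); split; first by rewrite /down_bond wk wk1.
  apply: (@flat_intro _ _ N_gt0 n_ge3 _ X i 1 j
    (n (nxt (nxt X))).-1 (n X).-2.+1) => //.
  by rotate [:: X] rw'.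
case: j rw ij => [|j] rw ij; first by lia.
have [|k [wk wk1 rw']] := @bond_exists _ _ N_gt0 w (X :: [:: X])
    (nxt (nxt X)) (nxt X) (nseq j (nxt X) ++
     nseq (n (nxt (nxt X))).-1 (nxt (nxt X)) ++ nseq (n X).-2 X).
  by rotate (@nil species) rw.
exists k, j; split; first by rewrite /down_bond wk wk1.
apply: (@flat_intro _ _ N_gt0 n_ge3 _ X 0 1 j
  (n (nxt (nxt X))).-1 (n X).-2.+1) => //.
eapply (spells_rotE (p := [:: X]) (q := X :: nxt X :: nxt (nxt X) ::
  nseq j (nxt X) ++ nseq (n (nxt (nxt X))).-1 (nxt (nxt X)) ++
  nseq (n X).-2 X) rw'); by runs_eq.
Qed.

(** When the exchanged intruders X and Z stand at an end of the Y block, nothing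
    separates one of them from the next block and the result is a flat stretch
    inside the block of another species. *)
Lemma gate_step w k : gate w -> down_bond w k ->
  trap (swap w k) \/ exists e, flat (swap w k) e.
Proof.
move=> [X [i [j rw]]] dk; have ij := count_flat rw.
have [[_ f]|[_ rw']] := flat_step rw dk; first by right; exists (i + j).-1.
have [nX nY nZ] : [/\ 2 < n X, 2 < n (nxt X) & 2 < n (nxt (nxt X))] by [].
case: i rw rw' ij => [|i] rw rw' ij.
  right; exists ((n X).-1 + 0).
  apply: (@flat_intro _ _ N_gt0 n_ge3 _ (nxt (nxt X)) (n X).-1 1 0 j.-1
    (n (nxt (nxt X))).-1) => //.
  by rotate (X :: nxt (nxt X) :: X :: nseq j (nxt X) ++
             nseq (n (nxt (nxt X))).-1 (nxt (nxt X))) rw'.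
case: j rw rw' ij => [|j] rw rw' ij.
  right; exists (0 + (n (nxt (nxt X))).-1).
  apply: (@flat_intro _ _ N_gt0 n_ge3 _ (nxt X) 0 1 (n (nxt (nxt X))).-1
    (n X).-1 i) => //.
  eapply (spells_rotE (p := X :: nseq i (nxt X)) (q := nxt X :: nxt (nxt X) :: X ::
    nseq (n (nxt (nxt X))).-1 (nxt (nxt X)) ++ nseq (n X).-2 X) rw'); by runs_eq.
left; apply: (@trap_intro _ _ N_gt0 n_ge3 _ X i.+1 j.+1
  (n (nxt (nxt X))).-1 (n X).-2.+1) => //.
by rotate [:: X] rw'.
Qed.

(** The strata outside the levels have a bounded number of non-neutral bonds,
    whatever the size of the ring. *)
Definition bends w := \sum_(k : site N) (w k != w (ordS k)).

(** One step above a trap, with no way down but into a trap. *)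
Definition rim w := [/\ bends w <= 10, exists k, down_bond w k &
  forall k, down_bond w k -> trap (swap w k)].

Lemma swapK w (k : site N) : swap (swap w k) k = w.
Proof.
apply: val_inj; apply/ffunP => i; rewrite /= ffunE /= ffunE.
by rewrite tpermK.
Qed.

Lemma swap_down w (k : site N) : up_bond w k -> down_bond (swap w k) k.
Proof.
rewrite /up_bond /down_bond /swap /= !ffunE tpermL tpermR => /eqP ->.
by [].
Qed.

Definition turns (s : seq species) :=
  if s is a :: t then path_sum (fun x y => (x != y) : nat) a t else 0.

Lemma turns_cons x t : turns (x :: t) <= 1 + turns t.
Proof. by case: t => //= y t; case: (x != y). Qed.

Lemma turns_run i x t : turns (nseq i x ++ t) <= 1 + turns t.
Proof.
elim: i => [|i IH] /=; first by rewrite add1n.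
case: i IH => [|i] IH; first exact: turns_cons.
by rewrite /= eqxx.
Qed.

Lemma bends_le w x t : spells w (x :: t) -> bends w <= turns (x :: rcons t x).
Proof.
by move=> rw; rewrite /bends (sum_bonds N_gt0 (fun x y => (x != y) : nat) rw).
Qed.

End Families.

(* Adding a run adds at most one bend. *)
Ltac bends_tac N_gt0 rw := apply: leq_trans (bends_le N_gt0 rw) _;
  rewrite -cats1 -?cat_cons; repeat rewrite ?cat_cons -?catA;
  repeat (first [apply: leq_trans (turns_run _ _ _) _
                |apply: leq_trans (turns_cons _ _) _]; rewrite ltnS);
  done.

Section Bends.
Local Open Scope nat_scope.
Variables (N : nat) (n : species -> nat).
Hypothesis N_gt0 : 0 < N.
Hypothesis n_ge3 : forall a, 3 <= n a.
Implicit Types (w : config N n).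

Lemma trap_bends w : trap w -> bends w <= 10.
Proof.
move=> [X [i [j [_ _ rw]]]]. rewrite /trap_word in rw.
bends_tac N_gt0 rw.
Qed.

Lemma flat_bends w X i m j : spells w (flat_word n X i m j) -> bends w <= 10.
Proof.
move=> rw. rewrite /flat_word in rw.
bends_tac N_gt0 rw.
Qed.

End Bends.

(** * Traps and rims *)

Section Traps.
Local Open Scope nat_scope.
Variables (N : nat) (n : species -> nat).
Hypothesis N_gt0 : 0 < N.
Hypothesis n_ge3 : forall a, 3 <= n a.
Implicit Types (w : config N n).

(* Lists the down bonds of a word of runs, leaving one goal for each of them. *)
Ltac enum_down rw :=
  split; [bends_tac N_gt0 rw|];
  let k := fresh "k" in let dk := fresh "dk" in
  let b := fresh "b" in let p := fresh "p" in let q := fresh "q" in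
  let e := fresh "e" in let w' := fresh "w'" in
  intros k dk; have [] := down_inner N_gt0 rw dk;
  [ rewrite /= ?(last_cat, last_cons) ?last_run //=;
    match goal with X : species |- _ => by case: (X) end
  | intros p [b [q [e rw']]]; rewrite -[LHS]cats0 in e;
    repeat rewrite ?cat_cons ?cat0s -?catA in e;
    clear rw dk; move: (swap _ k) rw' => w' rw';
    bond_split e; try absurd_letters; subst b; try lia ].

(** A rim without the requirement that a down bond exists: this one is known from
    the climb that led there. *)
Definition shoulder w :=
  bends w <= 10 /\ forall k, down_bond w k -> trap (swap w k).

(** The four shapes of the next lemmas are reached from a trap X Y^i Z X Y^j Z^c X^d
    by breaking the first X Y pair, a pair next to the middle Z X, the last Y Z
    pair, or the Z X pair at the end. Besides undoing the climb, the only falls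
    lead to another trap, possibly of another species. *)
Lemma shoulder_XY w X i j c d : 0 < j -> 0 < c -> 0 < d ->
  spells w (nxt X :: X :: nseq i (nxt X) ++ nxt (nxt X) :: X :: nseq j (nxt X) ++
         nseq c (nxt (nxt X)) ++ nseq d X) -> shoulder w.
Proof.
move=> j0 c0 d0 rw; enum_down rw.
- apply: (@trap_intro _ _ N_gt0 n_ge3 _ X i.+1 j c d.+1) => //.
  by rotate [:: X] rw'.
- apply: (@trap_intro _ _ N_gt0 n_ge3 _ (nxt (nxt X)) d 2 j c) => //.
  by rotate (nxt X :: nxt (nxt X) :: X :: X :: nseq j (nxt X) ++
             nseq c (nxt (nxt X))) rw'.
Qed.

Lemma shoulder_YZ w X i j c d : 0 < i -> 0 < j -> 0 < c -> 0 < d ->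
  spells w (X :: nseq i (nxt X) ++ nxt (nxt X) :: nxt X :: X :: nseq j (nxt X) ++
         nseq c (nxt (nxt X)) ++ nseq d X) -> shoulder w.
Proof.
move=> i0 j0 c0 d0 rw; enum_down rw.
- apply: (@trap_intro _ _ N_gt0 n_ge3 _ X i.+1 j c d.+1) => //.
  by rotate [:: X] rw'.
- apply: (@trap_intro _ _ N_gt0 n_ge3 _ X i j.+1 c d.+1) => //.
  by rotate [:: X] rw'.
Qed.

Lemma shoulder_YZ' w X i j c d : 0 < i -> 0 < c -> 0 < d ->
  spells w (X :: nseq i (nxt X) ++ nxt (nxt X) :: X :: nseq j (nxt X) ++
    nxt (nxt X) :: nxt X :: nseq c (nxt (nxt X)) ++ nseq d X) -> shoulder w.
Proof.
move=> i0 c0 d0 rw; enum_down rw.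
- apply: (@trap_intro _ _ N_gt0 n_ge3 _ (nxt X) 2 c d.+1 i) => //.
  by rotate (X :: nseq i (nxt X)) rw'.
- apply: (@trap_intro _ _ N_gt0 n_ge3 _ X i j.+1 c.+1 d.+1) => //.
  by rotate [:: X] rw'.
Qed.

Lemma shoulder_ZX w X i j c d : 0 < i -> 0 < j -> 0 < c ->
  spells w (X :: nseq i (nxt X) ++ nxt (nxt X) :: X :: nseq j (nxt X) ++
    nseq c (nxt (nxt X)) ++ X :: nxt (nxt X) :: nseq d X) -> shoulder w.
Proof.
move=> i0 j0 c0 rw; have [d0|d0] := posnP d.
  rewrite d0 [nseq 0 X]/= in rw; enum_down rw.
  apply: (@trap_intro _ _ N_gt0 n_ge3 _ X i j c.+1 2) => //.
  by rotate [:: X] rw'.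
enum_down rw.
apply: (@trap_intro _ _ N_gt0 n_ge3 _ X i j c.+1 d.+2) => //.
by rotate [:: X] rw'.
Qed.

(** There are six up bonds. Breaking the middle Z X pair gives back the gate. The
    Y Z pair on its left and the X Y pair on its right give gates between other
    species when the Y run concerned has a single letter; everything else gives a
    rim. *)
Lemma trap_step w (k : site N) : trap w -> up_bond w k ->
  gate (swap w k) \/ rim (swap w k).
Proof.
move=> tw uk; have [X [i [j [i0 j0 rw]]]] := tw.
have d0 : 0 < (n X).-2 by have := n_ge3 X; lia.
have c0 : 1 < (n (nxt (nxt X))).-1 by have := n_ge3 (nxt (nxt X)); lia.
have back := swapK w k; have dk := swap_down uk.
have [] := up_inner N_gt0 rw uk.
  rewrite /trap_word /= !(last_cat, last_cons) (last_run _ _ d0).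
  by case: (X).
move=> p [a [q [e rw']]]; rewrite /trap_word -[LHS]cats0 in e.
repeat rewrite ?cat_cons ?cat0s -?catA in e.
move: {rw uk} (swap w k) back dk rw' => w' back dk rw'.
have {back dk} rimI : bends w' <= 10 ->
    (forall k, down_bond w' k -> trap (swap w' k)) -> rim w'.
  by move=> h1 h2; split=> //; exists k.
move: (n X).-2 (n (nxt (nxt X))).-1 d0 c0 e => d c d0 c0 e.
bond_split e; try absurd_letters; subst a; try lia.
- match goal with h : is_true (0 < ?x.+1) |- _ => rename x into i end.
  right; have [] := @shoulder_XY w' X i j c d j0 (ltnW c0) d0; last exact: rimI.
  by rotate (@nil species) rw'.
- match goal with h : is_true (0 < ?x.+1) |- _ => rename x into i end.
  case: i i0 rw' => [|i] _ rw'.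
    left; apply: (@gate_intro _ _ N_gt0 n_ge3 _ (nxt (nxt X)) d.+1 1 j c).
    by rotate (X :: nxt (nxt X) :: nxt X :: X :: nseq j (nxt X) ++
               nseq c (nxt (nxt X))) rw'.
  right; have [] := @shoulder_YZ w' X i.+1 j c d; rewrite ?(ltnW c0) //.
  by rotate (@nil species) rw'.
- left; apply: (@gate_intro _ _ N_gt0 n_ge3 _ X i j c d.+1).
  by rotate [:: X] rw'.
- match goal with h : is_true (0 < ?x.+1) |- _ => rename x into j end.
  case: j j0 rw' => [|j] _ rw'.
    left; apply: (@gate_intro _ _ N_gt0 n_ge3 _ (nxt X) 1 c d.+1 i).
    by rotate (X :: nseq i (nxt X)) rw'.
  right; have [] := @shoulder_YZ w' X i j.+1 c d; rewrite ?(ltnW c0) //.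
  by rotate (@nil species) rw'.
- match goal with h : is_true (0 < ?x.+1) |- _ => rename x into j end.
  match goal with h : is_true (1 < ?x.+1) |- _ => rename x into c end.
  right; have [] := @shoulder_YZ' w' X i j c d => //; try lia.
  by rotate (@nil species) rw'.
- match goal with h : is_true (1 < ?x.+1) |- _ => rename x into c end.
  match goal with h : is_true (0 < ?x.+1) |- _ => rename x into d end.
  right; have [] := @shoulder_ZX w' X i j c d => //; try lia.
  by rotate (@nil species) rw'.
Qed.

Lemma trap_gate w : trap w -> exists k, up_bond w k /\ gate (swap w k).
Proof.
move=> [X [i [j [i0 j0 rw]]]].
have [|k [wk wk1 rw']] := @bond_exists _ _ N_gt0 w (X :: nseq i (nxt X))
    (nxt (nxt X)) X (nseq j (nxt X) ++
     nseq (n (nxt (nxt X))).-1 (nxt (nxt X)) ++ nseq (n X).-2 X).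
  by rotate (@nil species) rw.
exists k; split; first by rewrite /up_bond wk wk1 nxt3.
apply: (@gate_intro _ _ N_gt0 n_ge3 _ X i j (n (nxt (nxt X))).-1 (n X).-2.+1).
by rotate [:: X] rw'.
Qed.

Lemma trap_no_down w (k : site N) : trap w -> ~ down_bond w k.
Proof.
move=> [X [i [j [i0 j0 rw]]]] dk.
have d0 : 0 < (n X).-2 by have := n_ge3 X; lia.
have c0 : 1 < (n (nxt (nxt X))).-1 by have := n_ge3 (nxt (nxt X)); lia.
have [] := down_inner N_gt0 rw dk.
  rewrite /trap_word /= !(last_cat, last_cons) (last_run _ _ d0).
  by case: (X).
move=> p [b [q [e rw']]]; rewrite /trap_word -[LHS]cats0 in e.
repeat rewrite ?cat_cons ?cat0s -?catA in e; clear rw dk rw'.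
move: (n X).-2 (n (nxt (nxt X))).-1 d0 c0 e => d c d0 c0 e.
by bond_split e; try absurd_letters; lia.
Qed.

End Traps.

(** * Segregated configurations *)

Section Ground.
Variables (N : nat) (n : species -> nat).
Hypothesis N_gt0 : (0 < N)%N.
Hypothesis n_ge3 : forall a, (3 <= n a)%N.
Hypothesis n_total : (n A + n B + n C = N.*2.+1)%N.
Implicit Types (w : config N n).

Definition ground_word : seq species :=
  nseq (n A) A ++ nseq (n B) B ++ nseq (n C) C.

Lemma nth_ground i : (i < N.*2.+1)%N -> nth A ground_word i =
  if (i < n A)%N then A else if (i < n A + n B)%N then B else C.
Proof.
move=> iL; rewrite /ground_word !nth_cat !size_nseq !nth_nseq.
case: ltnP => // iA; have -> : (i - n A < n B)%N = (i < n A + n B)%N by lia.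
by case: ltnP => // iB; have -> : (i - n A - n B < n C)%N by lia.
Qed.

Lemma size_ground : size ground_word = N.*2.+1.
Proof. by rewrite /ground_word !size_cat !size_nseq addnA. Qed.

Lemma segregated_spells (k : site N) : spells (segregated n_total k) ground_word.
Proof.
split; first exact: size_ground.
exists k => i iL; rewrite nth_ground // !ffunE.
suff -> : inZp (k + i) - k = inZp i :> site N by rewrite /= modn_small.
rewrite -[X in _ - X]valZpK; apply/eqP; rewrite subr_eq; apply/eqP.
by apply: val_inj; rewrite /= modnDm addnC.
Qed.

Lemma ground_segregated w : spells w ground_word -> Omega0 n_total w.
Proof.
move=> /spells_uniq/(_ (segregated_spells 0))[r hr]; exists (- inZp r) => //.
apply: val_inj; apply/ffunP => i /=.
have e : inZp (i + r) = i + inZp r :> site N.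
  by rewrite -{2}[i]valZpK; apply: val_inj; rewrite /= modnDm.
by rewrite (hr i) e !ffunE subr0 opprK.
Qed.

Lemma level0_Omega0 w : level w 0 -> Omega0 n_total w.
Proof.
case=> l [l3 rw l0]; have [cA cB cC] := count_lifted N_gt0 l3 rw.
apply: ground_segregated; move: rw; rewrite (inversions0_sorted l3 l0) !map_cat !map_nseq.
rewrite -cB -cC /= => rw; apply: (spells_rotE (p := nseq (occ 0 l) A ++
  nseq (n B) B ++ nseq (n C) C) (q := nseq (occ 3 l) A) rw); first by runs_eq.
by rewrite /ground_word; runs_eq.
Qed.

Lemma inversions_run i a (l : seq nat) : all (leq a) l ->
  inversions (nseq i a ++ l) = inversions l.
Proof.
move=> al; have cnt (s : seq nat) : all (leq a) s -> count (fun b => b < a)%N s = 0%N.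
  by elim: s => //= b s IH /andP[ab /IH ->]; rewrite ltnNge ab.
elim: i => //= i ->; rewrite cnt // all_cat al andbT all_nseq leqnn orbT //.
Qed.

Lemma Omega0_level0 w : Omega0 n_total w -> level w 0.
Proof.
case=> k _ <-; exists (nseq (n A) 0%N ++ nseq (n B) 1%N ++ nseq (n C) 2%N); split.
- by rewrite /lifted !all_cat !all_nseq !orbT.
- by rewrite !map_cat !map_nseq; exact: segregated_spells.
rewrite !inversions_run ?all_cat ?all_nseq ?orbT //.
by rewrite -[nseq _ _]cats0 inversions_run.
Qed.

Lemma flat0_Omega0 w : flat w 0 -> Omega0 n_total w.
Proof.
move=> [X [i [m [j [m0 ij rw]]]]]; have := count_flat N_gt0 rw.
have [i0 j0] : i = 0%N /\ j = 0%N by lia.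
have nA := n_ge3 A; have nB := n_ge3 B; have nC := n_ge3 C.
subst i j; rewrite add0n addn0 => mE; subst m; apply: ground_segregated.
rewrite /ground_word; case: X rw {m0 ij}; rewrite /flat_word /= => rw.
- rotate (A :: A :: nseq (n B) B ++ C :: nseq (n C).-1 C) rw.
- rotate (B :: B :: nseq (n C) C) rw.
- rotate [:: C; C] rw.
Qed.

End Ground.

(** * The Lyapunov function *)

Section Lyapunov.
Variables (R : realType) (N : nat) (n : species -> nat).
Hypothesis n_ge3 : forall a, (3 <= n a)%N.
Hypothesis n_total : (n A + n B + n C = N.*2.+1)%N.
Variable M : nat.
Hypothesis M_min : forall a, (M <= n a)%N.
Hypothesis M_ge3 : (3 <= M)%N.
Implicit Types (w : config N n) (k : site N).

Let N_gt0 : (0 < N)%N.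
Proof. by have := n_ge3 A; have := n_ge3 B; have := n_ge3 C; lia. Qed.

Variables (q x : R).
Hypothesis q_gt0 : 0 < q.
Hypothesis qx : 4 * q * x <= 1.

(** Flat stretches have values at most 4 (2N + 2) x^M = (K - 596) x^M, so that a gate
    falling into one of them loses at least 596 x^M. This has to outweigh the at
    most ten down bonds of a gate, each of which may lead up to a trap. *)
Definition top_level : R := 4 * (N.*2.+1)%:R + 600.
Notation K := top_level.
Hypothesis x_large : 2 * (K + 43) <= x.

(** The coefficients of x^M balance the following facts: the climbs from a
    configuration with at most ten bends raise the mean at a speed of at most
    (5/2) x^M, so that each flat step and each fall from a rim must lose more than
    5/2, whence the steps 4 and 3; a trap has at most ten up bonds, each gaining at
    most 3, against a loss of 40 at the bond that leads to a gate. On a shelf the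
    climbs contribute at most x^M for each down bond; any coefficient between 2
    and K would do. *)
Inductive value w : R -> Prop :=
| ValLevel h of (h < M)%N & level w h : value w (K * x ^+ h)
| ValShelf of level w M &
    (forall k, down_bond w k -> level (swap w k) M.-1) : value w (2 * x ^+ M)
| ValFlat e of (e <= N.*2.+1)%N & flat w e :
    value w (4 * e.+1%:R * x ^+ M)
| ValGate of gate w : value w (K * x ^+ M)
| ValTrap of trap w : value w ((K + 40) * x ^+ M)
| ValRim of rim w : value w ((K + 43) * x ^+ M).

Definition values : seq R :=
  [seq K * x ^+ h | h <- iota 0 M] ++
  [seq 4 * e.+1%:R * x ^+ M | e <- iota 0 N.*2.+2] ++
  [:: 2 * x ^+ M; K * x ^+ M; (K + 40) * x ^+ M; (K + 43) * x ^+ M].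

Lemma value_values w v : value w v -> v \in values.
Proof.
case=> [h hM _|_ _|e eL _|_|_|_]; rewrite !mem_cat.
- by apply/orP; left; apply/mapP; exists h; rewrite ?mem_iota.
- by rewrite !inE eqxx !orbT.
- by apply/or3P; constructor 2; apply/mapP; exists e; rewrite ?mem_iota.
- by rewrite !inE eqxx !orbT.
- by rewrite !inE eqxx !orbT.
- by rewrite !inE eqxx !orbT.
Qed.

(** A configuration may belong to several strata; with the minimum of its values,
    a drift estimate need only be made in a stratum where the minimum is attained,
    because the height of a neighbour is bounded by any of its values. *)
Definition height w : R :=
  foldr Num.min (x ^+ M.+1) [seq v <- values | `[< value w v >]].

Lemma K_ge : 600 <= K.
Proof. by rewrite /K lerDr mulr_ge0. Qed.

Lemma x_ge : 1200 <= x.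
Proof. by have := K_ge; move: x_large; lra. Qed.

Lemma x_gt0 : 0 < x.
Proof. by have := x_ge; lra. Qed.

Lemma xM_gt0 m : 0 < x ^+ m.
Proof. by rewrite exprn_gt0 // x_gt0. Qed.

Lemma value_bounds w v : value w v -> 0 <= v <= x ^+ M.+1.
Proof.
have K0 := K_ge; have xM := xM_gt0 M; have x0 := x_gt0.
have aux c : 0 <= c -> c <= K + 43 -> 0 <= c * x ^+ M <= x ^+ M.+1.
  move=> c0 cK; rewrite exprS mulr_ge0 ?ler_pM2r //=; last exact: ltW.
  by move: x_large; lra.
case=> [h hM _|_ _|e eL _|_|_|_].
- apply/andP; split; first by rewrite mulr_ge0 // ltW ?xM_gt0 //; lra.
  rewrite exprS ler_pM //; first lra; first exact: ltW (xM_gt0 _).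
    by move: x_large; lra.
  by rewrite ler_weXn2l 1?ltnW //; have := x_ge; lra.
- by apply: aux => //; lra.
- apply: aux; first by rewrite mulr_ge0.
  have : e.+1%:R <= (N.*2.+1)%:R + 1 :> R by rewrite -natr1 lerD2r ler_nat.
  by rewrite /K; lra.
- by apply: aux => //; lra.
- by apply: aux => //; lra.
- by apply: aux => //; lra.
Qed.

Lemma foldr_min_le d (s : seq R) v : v \in s -> foldr Num.min d s <= v.
Proof.
elim: s => //= a s IH; rewrite inE ge_min => /orP[/eqP->|/IH->].
  by rewrite lexx.
by rewrite orbT.
Qed.

Lemma foldr_min_in d (s : seq R) : foldr Num.min d s \in d :: s.
Proof.
elim: s => [|a s IH] /=; first by rewrite inE.
rewrite /Num.min; case: ifP => _; first by rewrite !inE eqxx orbT.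
by move: IH; rewrite !inE => /orP[->|->]; rewrite ?orbT.
Qed.

Lemma height_value w v : value w v -> height w <= v.
Proof.
move=> vw; apply: foldr_min_le; rewrite mem_filter (value_values vw) andbT.
exact/asboolP.
Qed.

Lemma height_cases w : height w = x ^+ M.+1 \/ value w (height w).
Proof.
have := foldr_min_in (x ^+ M.+1) [seq v <- values | `[< value w v >]].
rewrite -/(height w) inE => /orP[/eqP ->|]; first by left.
by rewrite mem_filter => /andP[/asboolP h _]; right.
Qed.

Definition charted w := exists v, value w v.

Lemma height_charted w : charted w -> value w (height w).
Proof.
move=> [v vw]; have [e|//] := height_cases w.
have := height_value vw; have /andP[_] := value_bounds vw.
by rewrite -{1}e => h1 h2; have -> : height w = v by apply/eqP; rewrite eq_le h1 h2.
Qed.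

Lemma height_uncharted w : ~ charted w -> height w = x ^+ M.+1.
Proof. by move=> nk; have [//|h] := height_cases w; case: nk; exists (height w). Qed.

Lemma height_ge0 w : 0 <= height w.
Proof.
have [->|/value_bounds/andP[]//] := height_cases w; exact: ltW (xM_gt0 _).
Qed.

Lemma height_le w : height w <= x ^+ M.+1.
Proof. by have [->|/value_bounds/andP[]] := height_cases w. Qed.

(** The generator of the chain, with the rate 1 given to neutral bonds too, as
    their exchange does nothing. *)
Definition gen (f : config N n -> R) w : R :=
  \sum_(k : site N) (if up_bond w k then q else 1) * (f (swap w k) - f w).

Lemma swap_neutral w k : w k = w (ordS k) -> swap w k = w.
Proof.
move=> e; apply: val_inj; apply/ffunP => i; rewrite /= ffunE.
by case: tpermP => [->|->|].
Qed.

Lemma up_not_down w k : up_bond w k -> down_bond w k -> False.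
Proof.
rewrite /up_bond /down_bond => /eqP e1 /eqP.
by rewrite e1; case: (w k).
Qed.

(** A bound u for climbs and d for falls, improved by g at one distinguished bond. *)
Lemma gen_le f (k0 : site N) w (u d g : R) :
  (forall k, up_bond w k ->
     q * (f (swap w k) - f w) <= q * u - (k == k0)%:R * g) ->
  (forall k, down_bond w k -> f (swap w k) - f w <= d - (k == k0)%:R * g) ->
  g = 0 \/ up_bond w k0 || down_bond w k0 ->
  gen f w <= q * u * (ups w)%:R + d * (downs w)%:R - g.
Proof.
move=> hu hd hg.
have -> : q * u * (ups w)%:R + d * (downs w)%:R - g =
  \sum_(k : site N) ((up_bond w k)%:R * (q * u) + (down_bond w k)%:R * d
                     - (k == k0)%:R * g).
  rewrite big_split big_split /= -!mulr_suml sumrN -mulr_suml.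
  have -> : \sum_(k : site N) (k == k0)%:R = 1 :> R.
    by rewrite (bigD1 k0) //= eqxx big1 ?addr0 // => k /negbTE ->.
  rewrite mul1r /ups /downs !natr_sum; ring.
apply: ler_sum => k _; case: (boolP (up_bond w k)) => uk.
  case: (boolP (down_bond w k)) => dk; first by have := up_not_down uk dk.
  by rewrite mul1r mul0r addr0; exact: hu.
case: (boolP (down_bond w k)) => dk; first by rewrite !mul1r mul0r add0r; exact: hd.
have e : w k = w (ordS k).
  move: uk dk; rewrite /up_bond /down_bond.
  by case: (w k) (w (ordS k)) => [] [].
rewrite (swap_neutral e) subrr mulr0 !mul0r !add0r.
case: hg => [->|]; first by rewrite mulr0 oppr0.
case: eqP => [<-|]; first by rewrite (negbTE uk) (negbTE dk).
by rewrite mul0r oppr0.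
Qed.

Lemma ups_bends w : (ups w + downs w <= bends w)%N.
Proof.
rewrite /ups /downs /bends -big_split /=; apply: leq_sum => k _.
rewrite /up_bond /down_bond.
by case: (w k) (w (ordS k)) => [] [].
Qed.

Lemma gen_le_plain f w (u d : R) :
  (forall k, up_bond w k -> f (swap w k) - f w <= u) ->
  (forall k, down_bond w k -> f (swap w k) - f w <= d) ->
  gen f w <= q * u * (ups w)%:R + d * (downs w)%:R.
Proof.
move=> hu hd; rewrite -[leRHS]subr0; apply: (@gen_le _ 0) => [k uk|k dk|].
- by rewrite mulr0 subr0 ler_pM2l //; exact: hu.
- by rewrite mulr0 subr0; exact: hd.
by left.
Qed.

Lemma downs_gt0 w k : down_bond w k -> (0 < downs w)%N.
Proof. by move=> dk; rewrite /downs (bigD1 k) //= dk. Qed.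

Lemma level_height w h : (0 < h <= M)%N -> level w h -> height w <= K * x ^+ h.
Proof.
move=> /andP[h0]; rewrite leq_eqVlt => /orP[/eqP -> lw|hM lw]; last first.
  exact: height_value (ValLevel hM lw).
case: (pselect (forall k, down_bond w k -> level (swap w k) M.-1)) => [all_down|].
  apply: le_trans (height_value (ValShelf lw all_down)) _.
  by rewrite ler_pM2r ?xM_gt0 //; have := K_ge; lra.
move=> /existsNP[k /not_implyP[dk nl]].
have [_ /(_ dk)[[_ /nl//]|[_ gw]]] := level_step N_gt0 n_ge3 M_min k lw (leqnn M).
exact: height_value (ValGate gw).
Qed.

(** The three terms are the drifts on the levels, on the traps and on the other
    strata. *)
Definition margin : R := Num.min ((1 - 4 * q * x) * (K * x / 2))
  (Num.min (10 * q * x ^+ M) (x ^+ M / 4)).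

(** A climb gains at most K x^h (x - 1) x at rate q and a fall loses at least
    K x^h (x - 1), if the level is h + 1; the difference is governed by
    q x (downs + 3) - downs <= - (1 - 4 q x), as there is at least one down bond. *)
Lemma drift_level w h : (h < M)%N -> level w h -> ~ Omega0 n_total w ->
  height w = K * x ^+ h -> gen height w <= - ((1 - 4 * q * x) * (K * x / 2)).
Proof.
move=> hM lw nw hw.
case: h => [|h] in hM lw hw *; first by case: nw; exact: level0_Omega0 lw.
have [k0 dk0] := level_down N_gt0 M_min lw (ltnW hM).
have D0 : 1 <= (downs w)%:R :> R by rewrite (ler_nat R 1) (downs_gt0 dk0).
have UD : (ups w)%:R <= (downs w)%:R + 3 :> R.
  by rewrite -(natrD R _ 3) ler_nat (level_ups N_gt0 M_min lw (ltnW hM)).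
have x0 := x_gt0; have xge := x_ge; have xh := xM_gt0 h; have K0 := K_ge.
have := @gen_le_plain height w (K * x ^+ h * x * (x - 1)) (- (K * x ^+ h * (x - 1))).
have [st_up st_down] : (forall k, up_bond w k -> level (swap w k) h.+2) /\
    (forall k, down_bond w k -> level (swap w k) h).
  split=> k; have [su sd] := level_step N_gt0 n_ge3 M_min k lw (ltnW hM) => //.
  by move=> /sd[[]//|[e]]; move: hM; rewrite e ltnn.
move=> /(_ _ _)/le_trans; apply.
- move=> k /st_up lu; rewrite hw; have := @level_height _ h.+2 hM lu.
  by rewrite !exprS; lra.
- move=> k /st_down ld; rewrite hw; have := height_value (ValLevel (ltnW hM) ld).
  by rewrite !exprS; lra.
set Kx := K * x ^+ h.
have Kx0 : K <= Kx.
  by rewrite ler_peMr //; [lra|rewrite exprn_ege1 //; lra].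
have -> : q * (Kx * x * (x - 1)) * (ups w)%:R + - (Kx * (x - 1)) * (downs w)%:R =
  (Kx * (x - 1)) * (q * x * (ups w)%:R - (downs w)%:R) by ring.
have h1 : q * x * (ups w)%:R - (downs w)%:R <= - (1 - 4 * q * x).
  have qx0 : 0 <= q * x by rewrite mulr_ge0 // ltW.
  have : q * x * (ups w)%:R <= q * x * ((downs w)%:R + 3) by rewrite ler_wpM2l.
  have : 0 <= (1 - q * x) * ((downs w)%:R - 1).
    by rewrite mulr_ge0 ?subr_ge0 //; move: qx qx0; lra.
  by lra.
have h2 : K * x / 2 <= Kx * (x - 1).
  have : K * (x - 1) <= Kx * (x - 1) by rewrite ler_wpM2r //; lra.
  have : 0 <= K * (x / 2 - 1) by rewrite mulr_ge0 //; lra.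
  by lra.
have h3 : 0 <= 1 - 4 * q * x by move: qx; lra.
have := ler_wpM2l h3 h2.
have : 0 <= Kx * (x - 1) by rewrite mulr_ge0 //; lra.
move=> p0; have := ler_wpM2l p0 h1; lra.
Qed.

Lemma drift_shelf w : level w M ->
  (forall k, down_bond w k -> level (swap w k) M.-1) ->
  height w = 2 * x ^+ M -> gen height w <= - (x ^+ M / 4).
Proof.
move=> lw lsw hw; have x0 := x_gt0; have K0 := K_ge; have xge := x_ge.
have Mp : M = M.-1.+1 by move: M_ge3; lia.
have [k0 dk0] : exists k, down_bond w k.
  by rewrite Mp in lw; apply: (level_down N_gt0 M_min lw); rewrite -Mp.
have D0 : 1 <= (downs w)%:R :> R by rewrite (ler_nat R 1) (downs_gt0 dk0).
have UD : (ups w)%:R <= (downs w)%:R + 3 :> R.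
  by rewrite -(natrD R _ 3) ler_nat (level_ups N_gt0 M_min lw (leqnn M)).
have xh := xM_gt0 M; have xh1 := xM_gt0 M.-1.
have xE : x ^+ M = x * x ^+ M.-1 by rewrite {1}Mp exprS.
have := @gen_le_plain height w (x * x ^+ M) (- (3/2) * x ^+ M).
move=> /(_ _ _)/le_trans; apply.
- by move=> k _; have := height_le (swap w k); rewrite hw exprS; lra.
- move=> k /lsw ld; rewrite hw.
  have hM : (M.-1 < M)%N by rewrite [X in (_ < X)%N]Mp.
  have := height_value (ValLevel hM ld).
  have : 0 <= (x / 2 - K) * x ^+ M.-1 by rewrite mulr_ge0 //; move: x_large; lra.
  by rewrite xE; lra.
have qx0 : 0 <= q * x by rewrite mulr_ge0 // ltW.
have h1 : q * x * (ups w)%:R <= (downs w)%:R.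
  have : q * x * (ups w)%:R <= q * x * ((downs w)%:R + 3) by rewrite ler_wpM2l.
  have : 0 <= (1 - 4 * q * x) * ((downs w)%:R) by rewrite mulr_ge0 //; move: qx; lra.
  have : 0 <= q * x * ((downs w)%:R - 1) by rewrite mulr_ge0 //; lra.
  by lra.
have := ler_wpM2r (ltW xh) h1; have := ler_wpM2r (ltW xh) D0; lra.
Qed.

(** With few bends, the cap x^(M+1) is good enough a bound for the height after a
    climb: ten climbs at rate q with 4 q x <= 1 amount to (10/4) x^M. *)
Lemma climb_le w v : (bends w <= 10)%N -> 0 <= v ->
  q * (x ^+ M.+1 - v) * (ups w)%:R <= 5 / 2 * x ^+ M.
Proof.
move=> bw v0; have U : (ups w)%:R <= 10 :> R.
  by rewrite (ler_nat R _ 10) (leq_trans _ bw) // (leq_trans _ (ups_bends w)) // leq_addr.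
have x0 := x_gt0; have xh := xM_gt0 M.
have : q * (x ^+ M.+1 - v) * (ups w)%:R <= q * x ^+ M.+1 * (ups w)%:R.
  by rewrite ler_wpM2r // ler_pM2l // gerBl.
have : q * x ^+ M.+1 * (ups w)%:R <= q * x ^+ M.+1 * 10.
  by rewrite ler_wpM2l // mulr_ge0 // ltW // exprn_gt0.
have : 4 * q * x * x ^+ M <= 1 * x ^+ M by rewrite ler_wpM2r // ltW.
by rewrite exprS; lra.
Qed.

Lemma drift_flat w e : flat w e -> ~ Omega0 n_total w ->
  height w = 4 * e.+1%:R * x ^+ M -> gen height w <= - (x ^+ M / 4).
Proof.
move=> fw nw hw; have xh := xM_gt0 M.
case: e => [|e] in fw hw *; first by case: nw; exact: flat0_Omega0 fw.
have [k0 dk0] := flat_down N_gt0 fw (ltn0Sn e).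
have D0 : 1 <= (downs w)%:R :> R by rewrite (ler_nat R 1) (downs_gt0 dk0).
have [X [i [m [j [m0 ij rw]]]]] := fw.
have bw := flat_bends N_gt0 rw.
have eL : (e.+1 <= N.*2.+1)%N.
  have := count_flat N_gt0 rw; rewrite -n_total.
  by case: (X) => /=; lia.
have := @gen_le_plain height w (x ^+ M.+1 - height w) (- 4 * x ^+ M).
move=> /(_ _ _)/le_trans; apply.
- by move=> k _; rewrite lerD2r height_le.
- move=> k dk; have [[_ fk]|[]] := flat_step N_gt0 n_ge3 rw dk; last by lia.
  rewrite ij /= in fk; have := height_value (ValFlat (ltnW eL) fk).
  by rewrite hw -(natr1 e.+1); lra.
have := climb_le bw (height_ge0 w); have := ler_wpM2r (ltW xh) D0; lra.
Qed.

(** One fall loses 596 x^M; the other falls, at most ten in all, may gain 40 x^M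
    by leading to a trap. In the bound the distinguished fall is also charged this
    gain, whence 636 = 596 + 40. *)
Lemma drift_gate w : gate w -> height w = K * x ^+ M ->
  gen height w <= - (x ^+ M / 4).
Proof.
move=> gw hw; have xh := xM_gt0 M.
have flat_le v e : flat v e -> height v <= (K - 596) * x ^+ M.
  move=> fv; have eL : (e <= N.*2.+1)%N.
    have [X [i [m [j [m0 <- rv]]]]] := fv.
    by have := count_flat N_gt0 rv; rewrite -n_total; case: (X) => /=; lia.
  apply: le_trans (height_value (ValFlat eL fv)) _; rewrite ler_pM2r //.
  have : e.+1%:R <= (N.*2.+1)%:R + 1 :> R by rewrite -natr1 lerD2r ler_nat.
  by rewrite /K; lra.
have [k0 [e0 [dk0 fk0]]] := gate_down N_gt0 n_ge3 gw.
have bw : (bends w <= 10)%N by have [X [i [j rw]]] := gw; exact: flat_bends rw.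
have DB : (downs w)%:R <= 10 :> R.
  by rewrite (ler_nat R _ 10) (leq_trans _ bw) // (leq_trans _ (ups_bends w)) // leq_addl.
have := @gen_le height k0 w (x ^+ M.+1 - height w) (40 * x ^+ M) (636 * x ^+ M).
move=> /(_ _ _ _)/le_trans; apply.
- move=> k uk; have /negbTE -> : k != k0.
    by apply/eqP => kk; rewrite kk in uk; exact: up_not_down uk dk0.
  by rewrite mul0r subr0 ler_pM2l // lerD2r height_le.
- move=> k dk; case: eqVneq => [->|_].
    by rewrite mul1r; have := flat_le _ _ fk0; rewrite hw; lra.
  rewrite mul0r subr0 hw.
  have [tk|[e fk]] := gate_step N_gt0 n_ge3 gw dk.
    by have := height_value (ValTrap tk); lra.
  by have := flat_le _ _ fk; lra.
- by right; rewrite dk0 orbT.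
have := climb_le bw (height_ge0 w); have := ler_wpM2r (ltW xh) DB; lra.
Qed.

(** The bond to the gate loses 40, and is also charged the gain 3 of the others,
    whence 43. *)
Lemma drift_trap w : trap w -> height w = (K + 40) * x ^+ M ->
  gen height w <= - (10 * q * x ^+ M).
Proof.
move=> tw hw; have xh := xM_gt0 M.
have [k0 [uk0 gk0]] := trap_gate N_gt0 n_ge3 tw.
have bw := trap_bends N_gt0 tw.
have U : (ups w)%:R <= 10 :> R.
  by rewrite (ler_nat R _ 10) (leq_trans _ bw) // (leq_trans _ (ups_bends w)) // leq_addr.
have := @gen_le height k0 w (3 * x ^+ M) 0 (q * (43 * x ^+ M)).
move=> /(_ _ _ _)/le_trans; apply.
- move=> k uk; case: eqVneq => [->|_].
    rewrite mul1r -mulrBr ler_pM2l //.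
    by have := height_value (ValGate gk0); rewrite hw; lra.
  rewrite mul0r subr0 ler_pM2l // hw.
  have [gk|rk] := trap_step N_gt0 n_ge3 tw uk.
    by have := height_value (ValGate gk); lra.
  by have := height_value (ValRim rk); lra.
- by move=> k dk; case: (trap_no_down N_gt0 n_ge3 tw dk).
- by right; rewrite uk0.
have qxM : 0 < q * x ^+ M by rewrite mulr_gt0.
have := ler_wpM2l (ltW qxM) U; lra.
Qed.

Lemma drift_rim w : rim w -> height w = (K + 43) * x ^+ M ->
  gen height w <= - (x ^+ M / 4).
Proof.
move=> [bw [k0 dk0] tw] hw; have xh := xM_gt0 M.
have D0 : 1 <= (downs w)%:R :> R by rewrite (ler_nat R 1) (downs_gt0 dk0).
have := @gen_le_plain height w (x ^+ M.+1 - height w) (- 3 * x ^+ M).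
move=> /(_ _ _)/le_trans; apply.
- by move=> k _; rewrite lerD2r height_le.
- by move=> k /tw tk; have := height_value (ValTrap tk); rewrite hw; lra.
have := climb_le bw (height_ge0 w); have := ler_wpM2r (ltW xh) D0; lra.
Qed.

Lemma drift_charted w : charted w -> ~ Omega0 n_total w ->
  gen height w <= - margin.
Proof.
move=> kw nw; have := height_charted kw.
have m1 : margin <= (1 - 4 * q * x) * (K * x / 2) by rewrite ge_min lexx.
have m2 : margin <= 10 * q * x ^+ M by rewrite !ge_min lexx orbT.
have m3 : margin <= x ^+ M / 4 by rewrite !ge_min lexx !orbT.
have fin z : margin <= z -> gen height w <= - z -> gen height w <= - margin.
  by move=> h1 h2; apply: le_trans h2 _; rewrite lerN2.
move: {-2}(height w) (erefl (height w)) => v hv vw.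
case: vw hv => [h hM lw|lw lsw|e eL fw|gw|tw|rw] hv.
- exact: fin m1 (drift_level hM lw nw (esym hv)).
- exact: fin m3 (drift_shelf lw lsw (esym hv)).
- exact: fin m3 (drift_flat fw nw (esym hv)).
- exact: fin m3 (drift_gate gw (esym hv)).
- exact: fin m2 (drift_trap tw (esym hv)).
- exact: fin m3 (drift_rim rw (esym hv)).
Qed.

Lemma drift_uncharted w : ~ charted w -> gen height w <= 0.
Proof.
move=> nk; apply: sumr_le0 => k _; rewrite mulr_ge0_le0 //.
  by case: ifP => // _; exact: ltW.
by rewrite subr_le0 (height_uncharted nk) height_le.
Qed.

(** Without inversions there is no down bond, hence there are at most three up
    bonds. *)
Lemma drift_Omega0 w : Omega0 n_total w -> gen height w <= 3 * q * K * x.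
Proof.
move=> /(Omega0_level0 N_gt0) lw; have K0 := K_ge; have x0 := x_gt0.
have M0 : (0 < M)%N by move: M_ge3; lia.
have nd k : ~ down_bond w k.
  have [_ st] := level_step N_gt0 n_ge3 M_min k lw (leq0n M).
  by move=> /st[[//]|[e]]; rewrite -e in M0.
have U : (ups w)%:R <= 3 :> R.
  have := level_ups N_gt0 M_min lw (leq0n M).
  have -> : downs w = 0%N by rewrite /downs big1 // => k _; case: (boolP (down_bond w k)) => // /nd.
  by rewrite (ler_nat R _ 3).
have := @gen_le_plain height w (K * x) 0.
move=> /(_ _ _)/le_trans; apply.
- move=> k uk; have [su _] := level_step N_gt0 n_ge3 M_min k lw (leq0n M).
  have lu := su uk; have := @level_height _ 1 M0 lu.
  by rewrite expr1; have := height_ge0 w; lra.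
- by move=> k /nd.
have Kx0 : 0 <= q * (K * x) by rewrite !mulr_ge0 //; [exact: ltW|lra|exact: ltW].
have := ler_wpM2l Kx0 U; lra.
Qed.

Lemma height_Omega0 w : Omega0 n_total w -> height w <= K.
Proof.
move=> /(Omega0_level0 N_gt0) lw.
have M0 : (0 < M)%N := leq_trans (isT : (0 < 3)%N) M_ge3.
by have := height_value (ValLevel M0 lw); rewrite expr0 mulr1.
Qed.

End Lyapunov.

(** The chart does not depend on the scale x of the values, which allows the two
    scales to be used together. *)
Lemma charted_scale (R : realType) N n M (x y : R) (w : config N n) :
  charted M x w -> charted M y w.
Proof.
case=> v [h hM lw|lw sw|e eL fw|gw|tw|rw]; eexists.
- exact: ValLevel hM lw.
- exact: ValShelf lw sw.
- exact: ValFlat eL fw.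
- exact: ValGate gw.
- exact: ValTrap tw.
- exact: ValRim rw.
Qed.

(** * Drift inequalities for continuous-time chains on a finite space *)

Section Semigroup.
Variables (R : realType) (X : finType).
Variables (p : R -> X -> X -> R) (L : (X -> R) -> X -> R).
Hypothesis p_semigroup : is_transition_semigroup p.
Hypothesis p_gen : has_generator p L.

Lemma at_right0_ex (Q : R -> Prop) : (\forall h \near (0 : R)^'+, Q h) ->
  exists2 e, 0 < e & forall h, 0 < h < e -> Q h.
Proof.
rewrite near_withinE near_nbhs => /nbhs_ballP[e /= e0 he]; exists e => //.
move=> h /andP[h0 heps]; apply: he => //.
by rewrite /ball /= sub0r normrN gtr0_norm.
Qed.

(** On a finite space the derivative at 0 is uniform in the starting point. *)
Lemma semigroup_step (F : X -> R) (e : R) : 0 < e ->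
  exists2 h0, 0 < h0 & forall h x, 0 < h < h0 ->
    \sum_y p h x y * F y <= F x + h * (L F x + e).
Proof.
move=> e0; have /at_right0_ex[h0 h00 hh0] : \forall h \near (0 : R)^'+,
    forall x, h^-1 * ((\sum_y p h x y * F y) - F x) < L F x + e.
  apply: filter_forall => x.
  by apply: (cvgr_lt _ (@p_gen F x)); rewrite ltrDl.
exists h0 => // h x hh; have h_gt0 : 0 < h by case/andP: hh.
have := hh0 h hh x; rewrite mulrC ltr_pdivrMr // ltrBlDl mulrC.
by move=> /ltW; rewrite mulrC [X in _ + X]mulrC.
Qed.

Lemma semigroup_mul_nat h x y n : 0 <= h ->
  p (n.+1%:R * h) x y = \sum_z p (n%:R * h) x z * p h z y.
Proof.
have [_ _ _ ck] := p_semigroup => h0.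
by rewrite -natr1 mulrDl mul1r ck // mulr_ge0.
Qed.

(** A discrete form of Dynkin's inequality: each step of the grid raises the mean
    of F by at most h (a + e) and lowers it by b h times the probability of B.
    Working on a grid, the inequality needs no regularity of the semigroup beyond
    its derivative at 0. *)
Lemma grid_drift (F : X -> R) (B : pred X) (a b e : R) x0 : 0 < e ->
  (forall x, L F x <= a - b * (B x)%:R) ->
  exists2 h0, 0 < h0 & forall h m, 0 < h < h0 ->
    \sum_y p (m%:R * h) x0 y * F y +
      b * h * (\sum_(i < m) \sum_(y | B y) p (i%:R * h) x0 y)
    <= F x0 + m%:R * h * (a + e).
Proof.
move=> e0 drift; have [h0 h00 step] := semigroup_step F e0.
have [p_ge0 p_sum p0 ck] := p_semigroup.
exists h0 => // h m hh; have /andP[h_gt0 _] := hh; have h_ge0 := ltW h_gt0.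
elim: m => [|m IH].
  rewrite big_ord0 mulr0 addr0 !mul0r addr0 (bigD1 x0) //= p0 eqxx mul1r.
  rewrite big1 ?addr0 // => y /negbTE yx; by rewrite p0 eq_sym yx mul0r.
rewrite big_ord_recr /= mulrDr.
set S := \sum_(i < m) _ in IH *.
have key : \sum_y p (m.+1%:R * h) x0 y * F y <=
    \sum_z p (m%:R * h) x0 z * F z + h * (a + e) -
    b * h * \sum_(y | B y) p (m%:R * h) x0 y.
  under eq_bigr => y _ do rewrite semigroup_mul_nat // mulr_suml.
  rewrite exchange_big /=.
  have mh0 : 0 <= m%:R * h by rewrite mulr_ge0.
  have -> : \sum_z p (m%:R * h) x0 z * F z + h * (a + e) -
      b * h * \sum_(y | B y) p (m%:R * h) x0 y =
    \sum_z p (m%:R * h) x0 z * (F z + h * (a - b * (B z)%:R + e)).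
    have -> : h * (a + e) = \sum_z p (m%:R * h) x0 z * (h * (a + e)).
      by rewrite -mulr_suml p_sum // mul1r.
    rewrite [\sum_(y | B y) _]big_mkcond /= mulr_sumr -sumrN -!big_split /=.
    by apply: eq_bigr => z _; case: (B z); rewrite /=; ring.
  apply: ler_sum => z _; under eq_bigr => y _ do rewrite -mulrA.
  rewrite -mulr_sumr ler_wpM2l ?p_ge0 //.
  apply: le_trans (step h z hh) _; rewrite lerD2l ler_pM2l // lerD2r.
  exact: drift.
have -> : m.+1%:R * h * (a + e) = m%:R * h * (a + e) + h * (a + e).
  by rewrite -natr1; ring.
by move: IH key; lra.
Qed.

Lemma grid_mean (F : X -> R) (a e : R) x0 : 0 < e ->
  (forall x, L F x <= a) ->
  exists2 h0, 0 < h0 & forall h m, 0 < h < h0 ->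
    \sum_y p (m%:R * h) x0 y * F y <= F x0 + m%:R * h * (a + e).
Proof.
move=> e0 drift; have [|h0 h00 H] := @grid_drift F xpred0 a 0 e x0 e0.
  by move=> x; rewrite mul0r subr0.
exists h0 => // h m hh; have := H h m hh.
by rewrite !mul0r addr0.
Qed.

End Semigroup.

(** * Occupation integrals as limits of Riemann sums *)

Section Paths.
Variables (R : realType).
Notation leb := (@lebesgue_measure R).

(** Right ends of the intervals are used because g will be right-continuous: as h
    tends to 0, the argument of g tends to s strictly from the right. *)
Definition right_step (g : R -> R) (h : R) (m : nat) (s : R) : R :=
  \sum_(i < m) g (i.+1%:R * h) * \1_(`[i%:R * h, i.+1%:R * h[%classic) s.

Lemma right_step_at g h m s : 0 < h -> 0 <= s < m%:R * h ->
  exists2 i : nat, s < i.+1%:R * h <= s + h &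
    right_step g h m s = g (i.+1%:R * h).
Proof.
move=> h0 /andP[s0 sm]; have sh0 : 0 <= s / h by rewrite divr_ge0 // ltW.
have /andP[i1 i2] := Num.Theory.truncn_itv sh0; set i := Num.truncn _ in i1 i2.
move: i1 i2; rewrite ler_pdivlMr // ltr_pdivrMr // => i1 i2.
have im : (i < m)%N.
  by rewrite -(ltr_nat R) -(ltr_pM2r h0); exact: le_lt_trans i1 sm.
exists i; first by rewrite i2 -natr1 mulrDl mul1r lerD2r.
rewrite /right_step (bigD1 (Ordinal im)) //= indicE mem_set ?mulr1; last first.
  by rewrite /= in_itv /= i1 i2.
rewrite big1 ?addr0 // => j; rewrite -val_eqE /= => ji.
rewrite indicE memNset ?mulr0 //= in_itv /= => /andP[j1 j2].
case/negP: ji; rewrite eqn_leq; apply/andP; split.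
  by rewrite -ltnS -(ltr_nat R) -(ltr_pM2r h0); exact: le_lt_trans j1 i2.
by rewrite -ltnS -(ltr_nat R) -(ltr_pM2r h0); exact: le_lt_trans i1 j2.
Qed.

Lemma measurable_right_step g h m (D : set R) :
  measurable_fun D (right_step g h m).
Proof.
apply: (@measurable_sum _ _ _ D 'I_m (index_enum 'I_m)) => i.
apply: measurable_funM; first exact: measurable_cst.
exact: measurable_indic.
Qed.

Lemma integral_right_step (g : R -> R) (h : R) m : 0 < h -> (forall s, 0 <= g s) ->
  (\int[leb]_(s in `[0%R, (m%:R * h)%R[%classic) (right_step g h m s)%:E =
   (\sum_(i < m) g (i.+1%:R * h) * h)%R%:E)%E.
Proof.
move=> h0 g0; rewrite /right_step.
under eq_integral do rewrite -sumEFin.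
rewrite ge0_integral_sum //=; first last.
- by move=> i s _; rewrite lee_fin mulr_ge0.
- move=> i; apply/measurable_EFinP; apply: measurable_funM; first exact: measurable_cst.
  exact: measurable_indic.
rewrite -sumEFin; apply: eq_bigr => i _.
under eq_integral do rewrite EFinM.
rewrite ge0_integralZl_EFin //; last first.
  by apply/measurable_EFinP; exact: measurable_indic.
rewrite integral_indic // EFinM; congr (_ * _)%E.
have -> : `[i%:R * h, i.+1%:R * h[%classic `&` `[0, m%:R * h[%classic =
          `[i%:R * h, i.+1%:R * h[%classic.
  apply/seteqP; split=> [s []//|s /= ]; rewrite !in_itv /= => /andP[s1 s2]; split.
    by rewrite s1 s2.
  rewrite (le_trans _ s1) ?mulr_ge0 //=; last exact: ltW.
  by apply: lt_le_trans s2 _; rewrite ler_pM2r // ler_nat.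
rewrite /= lebesgue_measure_itv /= lte_fin ltr_pM2r // ltr_nat ltnSn.
by rewrite -EFinB -natr1 mulrDl mul1r addrAC subrr add0r.
Qed.

Lemma cvg_right_step (g : R -> R) (t s : R) : 0 < t -> 0 <= s < t ->
  (\forall u \near s^'+, g u = g s) ->
  right_step g (t / m.+1%:R) m.+1 s @[m --> \oo] --> g s.
Proof.
move=> t0 st; rewrite near_withinE near_nbhs => /nbhs_ballP[e /= e0 he].
apply: cvg_near_cst; near=> m.
have m0 : (0 : R) < m.+1%:R by [].
have h0 : 0 < t / m.+1%:R by rewrite divr_gt0.
have [|i /andP[i1 i2] ->] := @right_step_at g _ m.+1 s h0.
  by rewrite mulrCA divff ?gt_eqF // mulr1.
apply: he => //=; rewrite /ball /= distrC gtr0_norm ?subr_gt0 // ltrBlDl.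
apply: le_lt_trans i2 _; rewrite ltrD2l mulrC -ltr_pdivlMr //.
near: m; exact: (near_infty_natSinv_lt (PosNum (divr_gt0 e0 t0))).
Unshelve. all: by end_near.
Qed.

(** The step functions converge pointwise and are bounded by 1; their limit g is
    therefore measurable, and dominated convergence applies. *)
Lemma riemann_cvg (g : R -> R) (t : R) : 0 < t -> (forall s, 0 <= g s <= 1) ->
  (forall s, 0 <= s -> \forall u \near s^'+, g u = g s) ->
  \sum_(i < m.+1) g (i.+1%:R * (t / m.+1%:R)) * (t / m.+1%:R) @[m --> \oo] -->
  \int[leb]_(s in `[0, t]) g s.
Proof.
move=> t0 g01 gr; have g0 s : 0 <= g s by case/andP: (g01 s).
pose f m s := right_step g (t / m.+1%:R) m.+1 s.
have h0 m : 0 < t / m.+1%:R by rewrite divr_gt0.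
have mh m : m.+1%:R * (t / m.+1%:R) = t by rewrite mulrC divfK.
have fg s : `[0, t[%classic s -> f m s @[m --> \oo] --> g s.
  rewrite /= in_itv /= => /andP[s0 st]; apply: cvg_right_step => //; first by rewrite s0.
  exact: gr.
have mg : measurable_fun `[0, t[%classic g.
  by apply: (measurable_fun_cvg _ fg) => m; exact: measurable_right_step.
have f01 m s : `[0, t[%classic s -> 0 <= f m s <= 1.
  rewrite /= in_itv /= => /andP[s0 st].
  rewrite /f; have [|i _ ->] := @right_step_at g _ m.+1 s (h0 m); last exact: g01.
  by rewrite s0 mh.
have [] := @dominated_convergence _ _ _ leb `[0, t[%classic _
    (fun m s => (f m s)%:E) (fun s => (g s)%:E) (cst 1%E).
- by [].
- by move=> m; apply/measurable_EFinP; exact: measurable_right_step.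
- exact/measurable_EFinP.
- by apply: aeW => s Ds; apply: cvg_EFin; [exact: nearW|exact: fg].
- apply/integrableP; split; first exact: measurable_cst.
  under eq_integral do rewrite gee0_abs ?lee01 //=.
  by rewrite integral_cst //= lebesgue_measure_itv /= lte_fin t0 mul1e -EFinB ltry.
- apply: aeW => s m Ds; rewrite /= lee_fin.
  by have /andP[? ?] := f01 m s Ds; rewrite ger0_norm.
move=> ig _; under eq_cvg => m.
  rewrite /= -[X in `[0, X[%classic](mh m) integral_right_step //.
  over.
move=> h; rewrite -Rintegral_itv_bndo_bndc //.
rewrite /Rintegral; have : (\int[leb]_(s in `[0%R, t[) (g s)%:E)%E \is a fin_num.
  exact: integrable_fin_num.
move=> /fineK; set I := fine _ => IE; rewrite -IE in h.
exact: (fine_cvg h).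
Qed.

End Paths.

(** * Expected occupation times *)

Section Chains.
Variables (R : realType) (X : finType).
Variables (d : measure_display) (T : measurableType d) (P : probability T R).
Variables (x0 : X) (eta : R -> T -> X) (p : R -> X -> X -> R).
Notation leb := (@lebesgue_measure R).

Hypothesis eta_measurable :
  forall t x, 0 <= t -> measurable (eta t @^-1` [set x]).
Hypothesis eta_cadlag : forall w, cadlag_path (eta^~ w).
Hypothesis eta_start : P (eta 0 @^-1` [set x0]) = 1%E.
Hypothesis p_semigroup : is_transition_semigroup p.
Hypothesis eta_markov : markov_property P p eta.

(** The Markov property at the times 0 and s, the initial state being almost sure. *)
Lemma marginal s y : 0 <= s -> P (eta s @^-1` [set y]) = (p s x0 y)%:E.
Proof.
move=> s0; pose t := fun i : nat => if i is 0%N then 0 else s.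
pose z := fun i : nat => if i is 0%N then x0 else y.
have := @eta_markov 0%N t z (lexx _).
have -> : [set w | forall i : nat, (i <= 0)%N -> eta (t i) w = z i] =
          eta 0 @^-1` [set x0].
  apply/seteqP; split=> w /=; first by move/(_ 0%N isT).
  by move=> e [|i].
have -> : [set w | forall i : nat, (i <= 1)%N -> eta (t i) w = z i] =
          eta 0 @^-1` [set x0] `&` eta s @^-1` [set y].
  apply/seteqP; split=> w /=.
    by move=> h; split; [exact: (h 0%N)|exact: (h 1%N)].
  by move=> [e1 e2] [|[|i]].
rewrite eta_start mul1e /= subr0 => /(_ _)<-; last by case.
have m0 := @eta_measurable 0 x0 (lexx _); have ms := @eta_measurable s y s0.
rewrite setIC; apply/eqP; rewrite eq_le; apply/andP; split; last first.
  by apply: le_measure; rewrite ?inE //; exact: measurableI.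
rewrite [leLHS](measureDI P _ m0) // -[leRHS]add0e; apply: leeD => //.
have : (P (~` (eta 0%R @^-1` [set x0])) <= 0)%E.
  by rewrite probability_setC // eta_start subee.
apply: le_trans; apply: le_measure; rewrite ?inE //.
all: by [exact: measurableD|exact: measurableC|move=> w []].
Qed.

Let hit (B : pred X) s w : R := (B (eta s w))%:R.

Lemma hitE B s w :
  hit B s w = \sum_(y | B y) \1_(eta s @^-1` [set y]) w.
Proof.
rewrite /hit; case: (boolP (B (eta s w))) => Bw.
  rewrite (bigD1 (eta s w)) //= indicE mem_set // big1 ?addr0 // => y /andP[_ yw].
  by rewrite indicE memNset //= => e; rewrite e eqxx in yw.
rewrite big1 // => y By; rewrite indicE memNset //= => e.
by rewrite e By in Bw.
Qed.

Lemma measurable_hit B s : 0 <= s -> measurable_fun setT (hit B s).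
Proof.
move=> s0; rewrite (_ : hit B s = fun w =>
    \sum_(y <- enum B) \1_(eta s @^-1` [set y]) w); last first.
  by apply/funext => w; rewrite hitE big_enum.
by apply: measurable_sum => y; apply: measurable_indic; exact: eta_measurable.
Qed.

Lemma integral_hit B s : 0 <= s ->
  (\int[P]_w (hit B s w)%:E = (\sum_(y | B y) p s x0 y)%R%:E)%E.
Proof.
move=> s0; under eq_integral do rewrite hitE -sumEFin -big_enum /=.
rewrite ge0_integral_sum //; last first.
  by move=> y; apply/measurable_EFinP; apply: measurable_indic; exact: eta_measurable.
rewrite big_enum -sumEFin; apply: eq_bigr => y _.
rewrite integral_indic //; last exact: eta_measurable.
by rewrite setIT; exact: marginal.
Qed.

(** Dominated convergence exchanges the limit of the Riemann sums of a path with
    the expectation, which avoids measurability in the pair of time and chance. *)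
Lemma occupation_le (B : pred X) (tau t c : R) : 0 < t -> 0 < tau ->
  (\forall m \near \oo, \sum_(i < m.+1) (\sum_(y | B y)
     p (i.+1%:R * (t / m.+1%:R) * tau) x0 y) * (t / m.+1%:R) <= c) ->
  ('E_P[fun w => (\int[leb]_(s in `[0, t]) (B (eta (s * tau) w))%:R)%R]
     <= c%:E)%E.
Proof.
move=> t0 tau0 hc.
pose Z m w := \sum_(i < m.+1) hit B (i.+1%:R * (t / m.+1%:R) * tau) w * (t / m.+1%:R).
pose Y w := \int[leb]_(s in `[0, t]) (B (eta (s * tau) w))%:R.
have h0 m : 0 < t / m.+1%:R by rewrite divr_gt0.
have ZY w : Z m w @[m --> \oo] --> Y w.
  apply: (@riemann_cvg R (fun s => (B (eta (s * tau) w))%:R) t t0).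
    by move=> s; case: (B _); rewrite /= lexx ?ler01.
  move=> s s0; have [rc _] := eta_cadlag w.
  have /rc : 0 <= s * tau by rewrite mulr_ge0 // ltW.
  rewrite !near_withinE !near_nbhs => /nbhs_ballP[e /= e0 he].
  apply/nbhs_ballP; exists (e / tau) => /=; first by rewrite divr_gt0.
  move=> u /= su us; rewrite he //=; last by rewrite ltr_pM2r.
  move: su; rewrite /ball /= -mulrBl normrM (gtr0_norm tau0).
  by rewrite ltr_pdivlMr.
have mZ m : measurable_fun setT (Z m).
  apply: (@measurable_sum _ _ _ setT 'I_m.+1 (index_enum 'I_m.+1)) => i.
  apply: measurable_funM; last exact: measurable_cst.
  by apply: measurable_hit; rewrite !mulr_ge0 // ltW.
have Z0t m w : 0 <= Z m w <= t.
  apply/andP; split.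
    by apply: sumr_ge0 => i _; rewrite mulr_ge0 // ltW.
  have -> : t = \sum_(i < m.+1) t / m.+1%:R.
    by rewrite sumr_const card_ord -[RHS]mulr_natl mulrC divfK.
  apply: ler_sum => i _; apply: ler_piMl; first exact: ltW.
  by rewrite /hit; case: (B _); rewrite /= ?ler01.
have [] := @dominated_convergence _ _ _ P setT _
    (fun m w => (Z m w)%:E) (fun w => (Y w)%:E) (EFin \o cst t).
- by [].
- by move=> m; apply/measurable_EFinP.
- by apply/measurable_EFinP; apply: (measurable_fun_cvg mZ) => w _; exact: ZY.
- by apply: aeW => w _; apply: cvg_EFin; [exact: nearW|exact: ZY].
- exact: finite_measure_integrable_cst.
- apply: aeW => w m _; rewrite /= lee_fin.
  by have /andP[? ?] := Z0t m w; rewrite ger0_norm.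
move=> _ _ cv; rewrite unlock -(cvg_lim _ cv) //.
apply: lime_le; first by apply/cvg_ex; eexists; exact: cv.
near=> m; have : \sum_(i < m.+1) (\sum_(y | B y)
     p (i.+1%:R * (t / m.+1%:R) * tau) x0 y) * (t / m.+1%:R) <= c by near: m.
move=> hm; rewrite /= /Z; under eq_integral do rewrite -sumEFin.
rewrite ge0_integral_sum //; last 2 first.
- move=> i; apply/measurable_EFinP; apply: measurable_funM; last exact: measurable_cst.
  by apply: measurable_hit; rewrite !mulr_ge0 // ltW.
- by move=> i w _; rewrite lee_fin mulr_ge0 // ltW.
move: hm; rewrite -lee_fin; apply: le_trans.
rewrite -sumEFin lee_sum // => i _.
under eq_integral do rewrite mulrC EFinM.
have s0 : 0 <= i.+1%:R * (t / m.+1%:R) * tau by rewrite !mulr_ge0 // ltW.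
rewrite ge0_integralZl_EFin //; last 3 first.
- by move=> w _; rewrite lee_fin /hit.
- by apply/measurable_EFinP; exact: measurable_hit.
- exact: ltW.
by rewrite [X in (_ * X)%E](integral_hit B s0) -EFinM mulrC.
Unshelve. all: by end_near.
Qed.

End Chains.

(** * Time spent away from the segregated configurations *)

Section Occupation.
Variables (R : realType) (N : nat) (n : species -> nat).
Hypothesis n_ge3 : forall a, (3 <= n a)%N.
Hypothesis n_total : (n A + n B + n C = N.*2.+1)%N.
Variable M : nat.
Hypothesis M_min : forall a, (M <= n a)%N.
Hypothesis M_ge3 : (3 <= M)%N.
Variables (q x1 x2 tau t : R).
Hypothesis q_gt0 : 0 < q.
Hypothesis qx1 : 4 * q * x1 = 1.
Hypothesis qx2 : 8 * q * x2 = 1.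
Notation K := (top_level R N).
Hypothesis K_x2 : 2 * (K + 43) <= x2.
Hypothesis tau_gt0 : 0 < tau.
Hypothesis t_gt0 : 0 < t.
Variables (d : measure_display) (T : measurableType d) (P : probability T R).
Variables (w0 : config N n) (eta : R -> T -> config N n).
Hypothesis w0_ground : Omega0 n_total w0.
Hypothesis eta_chain : is_markov_chain P (gen q) w0 eta.

(** A configuration that is not segregated is either off the chart, which is
    improbable at any given time, or on the chart, where little time is spent. *)
Definition lost : pred (config N n) := fun w => `[< ~ charted M x1 w >].
Definition astray : pred (config N n) :=
  fun w => `[< charted M x1 w /\ ~ Omega0 n_total w >].

Let qx1_le : 4 * q * x1 <= 1. Proof. by rewrite qx1. Qed.
Let x2_gt0 : 0 < x2.
Proof. by have := K_ge R N; move: K_x2; lra. Qed.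
Let qx2_le : 4 * q * x2 <= 1.
Proof.
have : 0 < q * x2 by rewrite mulr_gt0.
by move: qx2; lra.
Qed.
Let x1E : x1 = 2 * x2.
Proof.
have q0 : q != 0 by rewrite gt_eqF.
apply: (mulfI q0); move: qx1 qx2; lra.
Qed.
Let K_x1 : 2 * (K + 43) <= x1.
Proof. by move: K_x2 x2_gt0 x1E; lra. Qed.

(** At x1 = 1/(4q) the margin vanishes, but the cap x1^(M+1) is as large as it can
    be, which gives the best bound for leaving the chart. *)
Lemma drift_lost (w : config N n) : gen q (height M x1) w <= 3 / 4 * K.
Proof.
have K0 : 0 <= 3 / 4 * K by have := K_ge R N; lra.
have [gw|ngw] := pselect (Omega0 n_total w).
  apply: le_trans (drift_Omega0 n_ge3 M_min M_ge3 q_gt0 qx1_le K_x1 gw) _.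
  have -> : 3 * q * K * x1 = 4 * q * x1 * (3 / 4 * K) by field.
  by rewrite qx1 mul1r.
apply: le_trans _ K0; have [kw|nkw] := pselect (charted M x1 w); last first.
  by have := drift_uncharted q_gt0 K_x1 nkw.
apply: le_trans (drift_charted n_ge3 M_min M_ge3 q_gt0 qx1_le K_x1 kw ngw) _.
rewrite oppr_le0 /margin !le_min qx1 subrr mul0r lexx /=.
have x10 : 0 <= x1 by rewrite x1E mulr_ge0 // ltW.
by rewrite !mulr_ge0 ?invr_ge0 ?exprn_ge0 // ltW.
Qed.

(** At x2 = 1/(8q) the levels have drift at most - K x2 / 4. For the traps and the
    other strata the drift is of order q x2^M and x2^M, which is larger in absolute value
    since q x2 is constant, M >= 3 and x2 >= 2K. *)
Lemma drift_astray (w : config N n) :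
  gen q (height M x2) w <= 3 / 8 * K - K * x2 / 4 * (astray w)%:R.
Proof.
have K0 := K_ge R N.
have [gw|ngw] := pselect (Omega0 n_total w).
  have -> : astray w = false by apply/asboolP => -[].
  apply: le_trans (drift_Omega0 n_ge3 M_min M_ge3 q_gt0 qx2_le K_x2 gw) _.
  have -> : 3 * q * K * x2 = 8 * q * x2 * (3 / 8 * K) by field.
  by rewrite qx2 mul1r mulr0 subr0.
have K1 : 0 <= 3 / 8 * K by move: K0; lra.
have [kw|nkw] := pselect (charted M x1 w); last first.
  have -> : astray w = false by apply/asboolP => -[].
  rewrite mulr0 subr0; apply: le_trans _ K1.
  have nkw2 : ~ charted M x2 w by move=> /(charted_scale x1).
  by have := drift_uncharted q_gt0 K_x2 nkw2.
have -> : astray w = true by apply/asboolP.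
have kw2 := charted_scale x2 kw.
apply: le_trans (drift_charted n_ge3 M_min M_ge3 q_gt0 qx2_le K_x2 kw2 ngw) _.
rewrite mulr1; apply: (@le_trans _ _ (- (K * x2 / 4))); last by move: K1; lra.
rewrite lerN2 /margin !le_min.
have x2K : 2 * K <= x2 by move: K_x2; lra.
have xM : x2 ^+ 3 <= x2 ^+ M.
  by rewrite ler_weXn2l // (le_trans _ x2K) //; move: K0; lra.
have h2 : K * x2 <= x2 ^+ 2.
  by rewrite expr2 ler_pM2r //; move: x2K K0; lra.
apply/and3P; split.
- have -> : 1 - 4 * q * x2 = 1 / 2 by move: qx2; lra.
  by rewrite le_eqVlt; apply/orP; left; apply/eqP; field.
- apply: (@le_trans _ _ (10 * q * x2 ^+ 3)); last first.
    by rewrite ler_pM2l // mulr_gt0.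
  have -> : 10 * q * x2 ^+ 3 = 5 / 4 * (8 * q * x2) * x2 ^+ 2 by field.
  by rewrite qx2 mulr1; have := sqr_ge0 x2; move: h2; lra.
- apply: (@le_trans _ _ (x2 ^+ 3 / 4)); last by rewrite ler_pM2r.
  rewrite ler_pM2r // (le_trans h2) // ler_weXn2l // (le_trans _ x2K) //.
  by move: K0; lra.
Qed.

(** The first term is t times the bound for the probability of being off the chart
    at each time up to t tau; the second, where 1/tau comes from the initial
    height, is the time astray, measured in units of tau. *)
Lemma occupation_bound :
  ('E_P[fun w => (\int[lebesgue_measure]_(s in `[0, t])
      \1_(~` Omega0 n_total) (eta (s * tau) w))%R]
   <= (t * (K * (1 + t * tau) / x1 ^+ M.+1)
       + 4 / x2 * (tau^-1 + 2 * t))%:E)%E.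
Proof.
have [eta_m eta_c eta0 [p [p_sg p_gen p_markov]]] := eta_chain.
have [p_ge0 _ _ _] := p_sg.
have K0 : 0 < K by have := K_ge R N; lra.
have x1_gt0 : 0 < x1 by rewrite x1E mulr_gt0.
have h1_ge0 (w : config N n) : 0 <= height M x1 w by have := height_ge0 M K_x1 w.
have h2_ge0 (w : config N n) : 0 <= height M x2 w by have := height_ge0 M K_x2 w.
have h1_0 : height M x1 w0 <= K.
  by have := height_Omega0 n_ge3 M_ge3 x1 w0_ground.
have h2_0 : height M x2 w0 <= K.
  by have := height_Omega0 n_ge3 M_ge3 x2 w0_ground.
have e1 : 0 < K / 4 by rewrite divr_gt0.
have e2 : 0 < 5 / 8 * K by rewrite mulr_gt0.
(* These errors complete the drift bounds 3K/4 and 3K/8 to K. *)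
have [d1 d1_gt0 mean1] := grid_mean p_sg p_gen w0 e1 drift_lost.
have [d2 d2_gt0 mean2] := grid_drift p_sg p_gen w0 e2 drift_astray.
pose E : pred (config N n) := fun w => w \in ~` Omega0 n_total.
apply: (occupation_le eta_m eta_c eta0 p_markov (B := E)) => //.
have tt_gt0 : 0 < t * tau by rewrite mulr_gt0.
have d_gt0 : 0 < Num.min d1 d2 / (t * tau) by rewrite divr_gt0 // lt_min d1_gt0.
near=> m; set h := t / m.+1%:R * tau.
have m_gt0 : (0 : R) < m.+1%:R by [].
have tm_gt0 : 0 < t / m.+1%:R by rewrite divr_gt0.
have h_gt0 : 0 < h by rewrite mulr_gt0.
have mh : m.+1%:R * h = t * tau.
  by rewrite /h mulrA mulrCA divff ?gt_eqF // mulr1.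
have : m.+1%:R^-1 < Num.min d1 d2 / (t * tau).
  by near: m; exact: (near_infty_natSinv_lt (PosNum d_gt0)).
have hE : m.+1%:R^-1 * (t * tau) = h by rewrite /h mulrA [_^-1 * t]mulrC.
rewrite ltr_pdivlMr // hE lt_min.
move=> /andP[hd1 hd2].
pose at_ (i : nat) w := p (i%:R * h) w0 w.
have at_ge0 i w : 0 <= at_ i w by apply: p_ge0; rewrite mulr_ge0 // ltW.
have split_E i : \sum_(y | E y) at_ i y <=
    \sum_(y | lost y) at_ i y + \sum_(y | astray y) at_ i y.
  rewrite [leLHS]big_mkcond [X in _ <= X + _]big_mkcond.
  rewrite [X in _ <= _ + X]big_mkcond -big_split /=; apply: ler_sum => y _.
  case: (boolP (E y)) => [|_].
    rewrite inE /= => ny; case: (boolP (lost y)) => [_|].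
      by rewrite lerDl; case: ifP.
    move=> /asboolP/contrapT ky; have -> : astray y = true by apply/asboolP.
    by rewrite add0r.
  by rewrite addr_ge0 //; case: ifP.
have lost_le i : (i <= m.+1)%N ->
    \sum_(y | lost y) at_ i y <= K * (1 + t * tau) / x1 ^+ M.+1.
  move=> im; rewrite ler_pdivlMr ?exprn_gt0 // mulr_suml.
  apply: (@le_trans _ _ (\sum_y at_ i y * height M x1 y)).
    rewrite big_mkcond; apply: ler_sum => y _; case: ifP => [/asboolP ly|_].
      by rewrite (height_uncharted ly).
    exact: mulr_ge0.
  have hd : 0 < h < d1 by rewrite h_gt0.
  apply: (le_trans (mean1 h i hd)).
  have -> : 3 / 4 * K + K / 4 = K by field.
  have ih : i%:R * h <= t * tau by rewrite -mh ler_pM2r // ler_nat.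
  have := ler_wpM2r (ltW K0) ih; move: h1_0; lra.
have astray_le : h * (\sum_(i < m.+1) \sum_(y | astray y) at_ i.+1 y) <=
    4 / x2 * (1 + 2 * (t * tau)).
  (* The grid inequality counts the left ends of the intervals, the Riemann sum
     the right ends: one more step is taken and the first term is dropped. *)
  have hd : 0 < h < d2 by rewrite h_gt0.
  have := mean2 h m.+2 hd; rewrite big_ord_recl /=.
  have -> : 3 / 8 * K + 5 / 8 * K = K by field.
  set SF := (X in X + _ <= _ -> _); set S0 := (X in _ * (X + _)).
  set S := (X in _ * (_ + X)).
  have S0_ge0 : 0 <= S0 by apply: sumr_ge0 => y _; exact: (at_ge0 0%N).
  have SF_ge0 : 0 <= SF.
    by apply: sumr_ge0 => y _; apply: mulr_ge0 => //; exact: (at_ge0 m.+2).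
  have mh2 : m.+2%:R * h <= 2 * (t * tau).
    by rewrite -mh mulrA ler_pM2r // -natrM ler_nat mul2n -addnn addnS ltnS leq_addr.
  move=> hh.
  have Kx2 : 0 < K * x2 / 4 by rewrite divr_gt0 // mulr_gt0.
  rewrite -(ler_pM2l Kx2).
  have -> : K * x2 / 4 * (4 / x2 * (1 + 2 * (t * tau))) = K * (1 + 2 * (t * tau)).
    by field; rewrite gt_eqF.
  have := ler_wpM2r (ltW K0) mh2.
  have : 0 <= K * x2 / 4 * h * S0 by rewrite !mulr_ge0 // ltW.
  move: hh h2_0; rewrite /S; lra.
have -> : \sum_(i < m.+1) (\sum_(y | E y) p (i.+1%:R * (t / m.+1%:R) * tau) w0 y)
      * (t / m.+1%:R) = \sum_(i < m.+1) (\sum_(y | E y) at_ i.+1 y) * (t / m.+1%:R).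
  by apply: eq_bigr => i _; congr (_ * _); apply: eq_bigr => y _;
     rewrite /at_ /h -mulrA.
apply: (@le_trans _ _ (\sum_(i < m.+1) (K * (1 + t * tau) / x1 ^+ M.+1
    + \sum_(y | astray y) at_ i.+1 y) * (t / m.+1%:R))).
  apply: ler_sum => i _; rewrite ler_pM2r //; apply: le_trans (split_E _) _.
  by rewrite lerD2r lost_le.
rewrite -mulr_suml big_split /= sumr_const card_ord mulrDl lerD //.
  rewrite -[_ *+ _]mulr_natr le_eqVlt; apply/orP; left; apply/eqP.
  by field; rewrite !gt_eqF ?exprn_gt0.
set S := \sum_(i < _) _ in astray_le *.
rewrite -(ler_pM2r tau_gt0).
have -> : S * (t / m.+1%:R) * tau = h * S by rewrite /h; ring.
apply: le_trans astray_le _; rewrite le_eqVlt; apply/orP; left; apply/eqP.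
by field; rewrite !gt_eqF.
Unshelve. all: by end_near.
Qed.

End Occupation.

Lemma ABC_generatorE (R : realType) N n (beta : R) :
  @ABC_generator R N n beta = gen (expR (- beta)).
Proof.
apply/funext => f; apply/funext => w; apply: eq_bigr => k _.
congr (_ * _); rewrite /jump_rate /up_bond.
by case: (w k) (w (ordS k)) => [] [].
Qed.

(** * Comparison of the scales *)

Section Scales.
Variables (R : realType) (N M Mstar : nat) (q r tau t : R).
Hypothesis N_ge4 : (4 <= N)%N.
Hypothesis M_Mstar : (M <= Mstar)%N.
Hypothesis q_gt0 : 0 < q.
Hypothesis rE : r = N%:R ^+ 3 * 4 ^+ Mstar * q.
Hypothesis r_small : r <= 10000^-1.
Hypothesis tauE : tau * q ^+ M = N%:R ^+ 2.
Hypothesis t_ge0 : 0 <= t.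
Notation K := (top_level R N).

Lemma top_level_le : K <= 160 * N%:R.
Proof.
rewrite /top_level; have -> : (N.*2.+1)%:R = 2 * N%:R + 1 :> R.
  by rewrite -natr1 -mul2n natrM.
have : (4 : R) <= N%:R by rewrite (ler_nat R 4).
by lra.
Qed.

Lemma rate_le : N%:R * q <= r.
Proof.
have N4 : (4 : R) <= N%:R by rewrite (ler_nat R 4).
rewrite rE ler_pM2r // exprS -mulrA ler_peMr //.
have h : (1 : R) <= N%:R ^+ 2 by rewrite exprn_ege1 //; lra.
have h' : (1 : R) <= 4 ^+ Mstar by rewrite exprn_ege1 // ler1n.
by rewrite -[leLHS]mul1r ler_pM.
Qed.

(** The largeness of x required by the Lyapunov function holds as soon as N q is
    small. *)
Lemma top_level_large : 2 * (K + 43) <= (8 * q)^-1.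
Proof.
have N4 : (4 : R) <= N%:R by rewrite (ler_nat R 4).
rewrite -[leRHS]mul1r ler_pdivlMr ?mulr_gt0 //.
have : q * (K + 43) <= q * (175 * N%:R).
  by rewrite ler_pM2l //; have := top_level_le; lra.
have := rate_le; move: r_small; lra.
Qed.

(** With tau q^M = N^2, the first term is of order N * N^2 * 4^M * q, the factor N
    coming from K; this is where the assumption of the limit is used in full. The
    second term is of order q. The constant is 704 = 640 + 64. *)
Lemma scales_le :
  t * (K * (1 + t * tau) / (4 * q)^-1 ^+ M.+1)
    + 4 / (8 * q)^-1 * (tau^-1 + 2 * t) <= 704 * (1 + t) ^+ 2 * r.
Proof.
have N4 : (4 : R) <= N%:R by rewrite (ler_nat R 4).
have t0 := t_ge0; have Nq := rate_le; have KN := top_level_le.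
have q_r : q <= r.
  by apply: le_trans Nq; rewrite ler_peMl ?ltW //; lra.
have q1 : q <= 1 by move: r_small; lra.
have qM : q ^+ M <= 1 by rewrite exprn_ile1 // ltW.
have qM_gt0 : 0 < q ^+ M by rewrite exprn_gt0.
have N2 : (1 : R) <= N%:R ^+ 2 by rewrite exprn_ege1 //; lra.
have tau_ge1 : 1 <= tau.
  rewrite -(ler_pM2r qM_gt0) mul1r tauE; exact: le_trans qM N2.
have tau_gt0 : 0 < tau by lra.
have invtau : tau^-1 <= 1 by rewrite invf_le1.
rewrite -exprVn !invrK.
have second : 4 * (8 * q) * (tau^-1 + 2 * t) <= 64 * (1 + t) * r.
  have h1 : tau^-1 + 2 * t <= 2 * (1 + t) by lra.
  have : 4 * (8 * q) * (tau^-1 + 2 * t) <= 4 * (8 * q) * (2 * (1 + t)).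
    by rewrite ler_wpM2l // !mulr_ge0 // ltW.
  have : (1 + t) * q <= (1 + t) * r by rewrite ler_wpM2l //; lra.
  by lra.
have p4 : (4 : R) ^+ M <= 4 ^+ Mstar by rewrite ler_weXn2l // ler1n.
have first : (1 + t * tau) * (4 * q) ^+ M.+1 <= 4 * (4 ^+ Mstar * q) * (N%:R ^+ 2 * (1 + t)).
  have -> : (1 + t * tau) * (4 * q) ^+ M.+1 =
      4 * (4 ^+ M * q) * (q ^+ M + t * (tau * q ^+ M)).
    by rewrite exprMn !exprS; ring.
  rewrite tauE; apply: ler_pM.
  - by rewrite !mulr_ge0 ?exprn_ge0 // ltW.
  - by rewrite addr_ge0 ?mulr_ge0 ?exprn_ge0 // ltW.
  - by rewrite ler_pM2l // ler_pM2r.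
  - by rewrite mulrDr mulr1 lerD //; [exact: le_trans qM N2|rewrite mulrC].
have : t * (K * (1 + t * tau) * (4 * q) ^+ M.+1) <=
   t * (160 * N%:R * (4 * (4 ^+ Mstar * q) * (N%:R ^+ 2 * (1 + t)))).
  rewrite ler_wpM2l // -mulrA ler_pM //.
  - by have := K_ge R N; lra.
  - rewrite mulr_ge0 // ?exprn_ge0 ?mulr_ge0 // ?addr_ge0 ?mulr_ge0 //; exact: ltW.
have -> : t * (160 * N%:R * (4 * (4 ^+ Mstar * q) * (N%:R ^+ 2 * (1 + t)))) =
   640 * t * (1 + t) * r by rewrite rE; ring.
have : 0 <= r by apply: le_trans q_r; exact: ltW.
move=> r0 h1; have r1 : 0 <= (1 + t) * r by rewrite mulr_ge0 //; lra.
have : 0 <= t * ((1 + t) * r) by rewrite mulr_ge0.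
by move: second; lra.
Qed.

End Scales.

(** * The low temperature limit *)

Theorem lemma2p1 (R : realType)
    (N : R -> nat) (n : R -> species -> nat)
    (n_ge3 : forall (beta : R) (a : species), (3 <= n beta a)%N)
    (n_total : forall beta : R,
      (n beta A + n beta B + n beta C = (N beta).*2.+1)%N)
    (M Mstar : R -> nat)
    (M_def : forall beta : R,
      M beta = minn (n beta A) (minn (n beta B) (n beta C)))
    (Mstar_def : forall beta : R,
      Mstar beta = maxn (n beta A) (maxn (n beta B) (n beta C)))
    (small : (N beta)%:R ^+ 3 * 4 ^+ Mstar beta * expR (- beta)
               @[beta --> +oo] --> (0 : R))
    (d : R -> measure_display)
    (T : forall beta : R, measurableType (d beta))
    (P : forall beta : R, probability (T beta) R)
    (k : forall beta : R, site (N beta))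
    (eta : forall beta : R, R -> T beta -> config (N beta) (n beta))
    (eta_ABC : forall beta : R,
      is_markov_chain (P beta) (@ABC_generator R (N beta) (n beta) beta)
        (segregated (n_total beta) (k beta)) (eta beta))
    (t : R) (t_ge0 : 0 <= t) :
  ('E_(P beta)[fun w =>
      (\int[lebesgue_measure]_(s in `[0, t])
        \1_(~` Omega0 (n_total beta))
          (eta beta (s * (N beta)%:R ^+ 2 * expR ((M beta)%:R * beta)) w))%R])%E
    @[beta --> +oo] --> (0 : \bar R)%E.
Proof.
move: t_ge0; rewrite le_eqVlt => /orP[/eqP <-|t_gt0].
  (* The grids used above need a nondegenerate time interval. *)
  apply: cvg_near_cst; near=> beta; rewrite unlock integral0_eq // => w _.
  by rewrite set_itv1 /Rintegral integral_set1.
pose r beta : R := (N beta)%:R ^+ 3 * 4 ^+ Mstar beta * expR (- beta).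
have pos : (0 : R) < 10000^-1 by rewrite invr_gt0 ltr0n.
apply: (@squeeze_cvge _ _ _ _ (cst 0%E) _ (fun beta => (704 * (1 + t) ^+ 2 * r beta)%:E)).
- near=> beta.
  have r_small : r beta <= 10000^-1.
    by apply/ltW; near: beta; exact: (cvgr_lt _ small _ pos).
  have N_ge4 : (4 <= N beta)%N.
    have := n_total beta; have := n_ge3 beta A.
    have := n_ge3 beta B; have := n_ge3 beta C; clear; lia.
  have M_min a : (M beta <= n beta a)%N.
    by rewrite M_def !geq_min; case: a; rewrite leqnn ?orbT.
  have M_ge3 : (3 <= M beta)%N by rewrite M_def !leq_min !n_ge3.
  have M_Mstar : (M beta <= Mstar beta)%N.
    by apply: leq_trans (M_min A) _; rewrite Mstar_def leq_maxl.
  set q := expR (- beta); have q_gt0 : 0 < q by exact: expR_gt0.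
  set tau := (N beta)%:R ^+ 2 * expR ((M beta)%:R * beta).
  have tauE : tau * q ^+ M beta = (N beta)%:R ^+ 2.
    by rewrite /tau /q -mulrA -expRM_natl -expRD mulrN subrr expR0 mulr1.
  have tau_gt0 : 0 < tau.
    by rewrite mulr_gt0 ?expR_gt0 // exprn_gt0 // ltr0n (leq_trans _ N_ge4).
  have qx1 : 4 * q * (4 * q)^-1 = 1 by rewrite mulfV // gt_eqF // mulr_gt0.
  have qx2 : 8 * q * (8 * q)^-1 = 1 by rewrite mulfV // gt_eqF // mulr_gt0.
  have large := top_level_large N_ge4 q_gt0 erefl r_small.
  apply/andP; split.
    rewrite unlock; apply: integral_ge0 => w _; rewrite lee_fin.
    by apply: fine_ge0; apply: integral_ge0 => s _; rewrite lee_fin.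
  have ground : Omega0 (n_total beta) (segregated (n_total beta) (k beta)) by exists (k beta).
  have chain := eta_ABC beta; rewrite ABC_generatorE in chain.
  have := occupation_bound (n_ge3 beta) M_min M_ge3 q_gt0 qx1 qx2 large
    tau_gt0 t_gt0 ground chain.
  have -> : (fun w => (\int[lebesgue_measure]_(s in `[0, t])
        \1_(~` Omega0 (n_total beta)) (eta beta (s * tau) w))%R) =
      (fun w => (\int[lebesgue_measure]_(s in `[0, t])
        \1_(~` Omega0 (n_total beta)) (eta beta
          (s * (N beta)%:R ^+ 2 * expR ((M beta)%:R * beta)) w))%R).
    by apply/funext => w; apply: eq_Rintegral => s _; rewrite /tau mulrA.
  move/le_trans; apply; rewrite lee_fin.
  exact: (scales_le N_ge4 M_Mstar q_gt0 erefl r_small tauE (ltW t_gt0)).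
- exact: cvg_cst.
- apply: cvg_EFin; first exact: nearW.
  rewrite -[X in _ --> X](mulr0 (704 * (1 + t) ^+ 2)).
  exact: (cvgM (cvg_cst _) small).
Unshelve. all: by end_near.
Qed.
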